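(* Let $\boldsymbol\nu$ be a shift-invariant tail measure on $\mathcal D$ with tail index $\alpha>0$ and tail process $\boldsymbol Y$. The following statements are equivalent. (i) There exist $\vartheta\in(0,\infty)$ and a random element $\boldsymbol Q$ in $\mathcal D$ such that $\mathbb P(\boldsymbol Q^*=1)=1$ and $$\boldsymbol\nu=\vartheta\int_{-\infty}^\infty\int_0^\infty\mathbb E[\delta_{uB^t\boldsymbol Q}]\,\alpha u^{-\alpha-1}\,\mathrm du\,\mathrm dt .\qquad(\ast)$$ (ii) $\mathbb P(\boldsymbol Y\in\mathcal D_0)=1$. (iii) $\mathbb P(\boldsymbol Y\in\mathcal D_\alpha)=1$. (iv) $\mathbb P(\mathcal E(\boldsymbol Y)<\infty)=1$. (v) $\boldsymbol\nu$ is supported on $\mathcal D_0$, i.e. $\boldsymbol\nu(\mathcal D\setminus\mathcal D_0)=0$. (vi) $\boldsymbol\nu$ is supported on $\mathcal D_\alpha$, i.e. $\boldsymbol\nu(\mathcal D\setminus\mathcal D_\alpha)=0$. If these conditions hold, then $\vartheta=\mathbb E[1/\mathcal E(\boldsymbol Y)]$, $\vartheta>0$, and the distribution of $\boldsymbol Q$ is given by $$\mathbb P_{\boldsymbol Q}=\vartheta^{-1}\,\mathbb E\left[\frac{\delta_{\boldsymbol Y/\boldsymbol Y^*}}{\mathcal E(\boldsymbol Y)}\right].$$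
   Context: Fix $d\ge1$ and a norm $|\cdot|$ on $\mathbb R^d$. $\mathcal D=\mathcal D(\mathbb R,\mathbb R^d)$ is the space of càdlàg functions $\mathbb R\to\mathbb R^d$ endowed with Skorohod's $J_1$ topology ($J_1$ convergence on compact intervals), a Polish space, with its Borel $\sigma$-field. $\boldsymbol 0$ is the null function; $\boldsymbol y_t$ is the value of $\boldsymbol y$ at $t$; $B^tf=f(\cdot-t)$; $\boldsymbol y^*=\sup_{t\in\mathbb R}|\boldsymbol y_t|$. $\mathcal D_0=\{\boldsymbol y\in\mathcal D:\lim_{|t|\to\infty}|\boldsymbol y_t|=0\}$, $\mathcal D_\alpha=\{\boldsymbol y\in\mathcal D:\int_{-\infty}^\infty|\boldsymbol y_t|^\alpha\,\mathrm dt<\infty\}$, and $\mathcal E(\boldsymbol y)=\int_{-\infty}^\infty\mathbb 1\{|\boldsymbol y_t|>1\}\,\mathrm dt\in[0,\infty]$. A set $A\subset\mathcal D$ is separated from $\boldsymbol 0$ if there are $a\le b$ with $\inf_{\boldsymbol y\in A}\sup_{a\le t\le b}|\boldsymbol y_t|>0$; $\mathcal B_0$ is the class of such sets. A Borel measure $\mu$ is $\mathcal B_0$-boundedly finite if $\mu(\{\boldsymbol 0\})=0$ and $\mu(A)<\infty$ for every Borel $A\in\mathcal B_0$. A tail measure on $\mathcal D$ with tail index $\alpha>0$ is a $\mathcal B_0$-boundedly finite Borel measure $\boldsymbol\nu$ with $\boldsymbol\nu(\{\boldsymbol 0\})=0$, $\boldsymbol\nu(\{\boldsymbol y:|\boldsymbol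 y_0|>1\})=1$ and $\boldsymbol\nu(tA)=t^{-\alpha}\boldsymbol\nu(A)$ for all $t>0$ and Borel $A$. It is shift-invariant if it is invariant under every $B^t$, $t\in\mathbb R$. Its tail process $\boldsymbol Y$ is a random element of $\mathcal D$ with distribution $\boldsymbol\nu(\cdot\cap\{\boldsymbol y:|\boldsymbol y_0|>1\})$. For a nonnegative random variable $W$ and a random element $X$, $\mathbb E[W\delta_X]$ denotes the measure $f\mapsto\mathbb E[Wf(X)]$.
   Formalization: Since Q in (i) is not unique (shifting Q gives another), the law of Q is stated as: some Q of (i) has exactly the displayed distribution, and every Q of (i) agrees with it on shift-invariant Borel sets. *)

(* Defs.v *)
From HB Require Import structures.
From mathcomp Require Import all_boot all_order all_algebra.
From mathcomp Require Import all_classical all_reals all_analysis.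
Import Order.TTheory GRing.Theory Num.Theory.
Import numFieldNormedType.Exports.

Set Implicit Arguments.
Unset Strict Implicit.
Unset Printing Implicit Defensive.

Local Open Scope classical_set_scope.
Local Open Scope ring_scope.

Record is_norm (R : realType) (d : nat) (N : 'rV[R]_d -> R) : Prop := IsNorm {
  is_norm_eq0 : forall x, N x = 0 -> x = 0;
  is_normZ : forall a x, N (a *: x) = `|a| * N x;
  is_norm_triangle : forall x y, N (x + y) <= N x + N y
}.

(* Convergence in R^d is that of the product topology of 'rV[R]_d, which is the
   topology of any norm. *)
Definition is_cadlag (R : realType) (d : nat) (f : R -> 'rV[R]_d) : Prop :=
  forall t, (f s @[s --> t^'+] --> f t) /\
            (exists l : 'rV[R]_d, f s @[s --> t^'-] --> l).

Record cadlag (R : realType) (d : nat) := Cadlag {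
  cadlag_fun :> R -> 'rV[R]_d;
  cadlagP : is_cadlag cadlag_fun
}.

Section operations.
Context {R : realType} {d : nat}.
Implicit Types (f : R -> 'rV[R]_d) (y : cadlag R d).

Lemma is_cadlag0 : is_cadlag (fun _ : R => 0 : 'rV[R]_d).
Proof. by move=> t; split; [exact: cvg_cst|exists 0; exact: cvg_cst]. Qed.

Lemma is_cadlag_scale (u : R) f : is_cadlag f -> is_cadlag (fun s => u *: f s).
Proof.
move=> fP t; have [fr [l fl]] := fP t; split; first exact: cvgZl_tmp.
by exists (u *: l); exact: cvgZl_tmp.
Qed.

Lemma is_cadlag_shift (t : R) f : is_cadlag f -> is_cadlag (fun s => f (s - t)).
Proof.
move=> fP s; have [fr [l fl]] := fP (s - t); split.
  apply: cvg_trans fr => A /= [e /= e0 eA]; exists e => //= z sz lt_sz.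
  by apply: eA; rewrite /= ?ltrD2r // opprD addrACA subrr addr0.
exists l; apply: cvg_trans fl => A /= [e /= e0 eA]; exists e => //= z sz lt_sz.
by apply: eA; rewrite /= ?ltrD2r // opprD addrACA subrr addr0.
Qed.

Definition cadlag0 : cadlag R d := Cadlag is_cadlag0.
Definition cadlag_scale (u : R) y : cadlag R d :=
  Cadlag (is_cadlag_scale u (cadlagP y)).
(* the shift operator B^t *)
Definition cadlag_shift (t : R) y : cadlag R d :=
  Cadlag (is_cadlag_shift t (cadlagP y)).

End operations.

Section skorohod.
Context (R : realType) (d : nat).
Implicit Types (f g : cadlag R d) (U : set (cadlag R d)).

(* A strictly increasing surjection of R is automatically a homeomorphism. *)
Definition time_change (lam : R -> R) : Prop :=
  {homo lam : s t / s < t} /\ (forall t, exists s, lam s = t).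

(* g_n -> f for J_1 on compact intervals iff for all K and e > 0 eventually
   g_n \in j1_nbhd f K e; since J_1 is metrizable, these sets (as K and e vary)
   form a base of neighbourhoods of f for J_1. *)
Definition j1_nbhd f (K e : R) : set (cadlag R d) :=
  [set g | exists lam, time_change lam /\
     forall t, - K <= t <= K -> `|lam t - t| < e /\ ball (f t) e (g (lam t))].

Definition j1_open U : Prop :=
  forall f, U f -> exists K e, 0 < e /\ j1_nbhd f K e `<=` U.

Lemma j1_nbhdS f K K' e e' :
  K' <= K -> e <= e' -> j1_nbhd f K e `<=` j1_nbhd f K' e'.
Proof.
move=> KK ee g [lam [lamP lamg]]; exists lam; split => // t /andP[Kt tK].
have [|l b] := lamg t.
  by rewrite (le_trans _ Kt) ?lerN2// (le_trans tK).
by split; [exact: lt_le_trans ee|exact: le_ball b].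
Qed.

Lemma j1_openT : j1_open setT.
Proof. by move=> f _; exists 0, 1; split. Qed.

Lemma j1_openI : setI_closed j1_open.
Proof.
move=> U V Uo Vo f [/Uo[K [e [e0 KU]]] /Vo[K' [e' [e'0 KV]]]].
exists (Num.max K K'), (Num.min e e'); split; first by rewrite lt_min e0.
by move=> g gf; split; [apply: KU|apply: KV]; apply: j1_nbhdS gf;
  rewrite ?le_max ?ge_min ?lexx ?orbT.
Qed.

Lemma j1_open_bigU (I : Type) (F : I -> set (cadlag R d)) :
  (forall i, j1_open (F i)) -> j1_open (\bigcup_i F i).
Proof.
move=> Fo f [i _ /Fo[K [e [e0 KF]]]]; exists K, e; split => //.
by move=> g /KF; exists i.
Qed.

HB.instance Definition _ := gen_eqMixin (cadlag R d).
HB.instance Definition _ := gen_choiceMixin (cadlag R d).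
HB.instance Definition _ := isPointed.Build (cadlag R d) cadlag0.
HB.instance Definition _ := isOpenTopological.Build (cadlag R d)
  j1_openT j1_openI j1_open_bigU.

(* Borel sigma-field *)
HB.instance Definition _ := @isMeasurable.Build
  (sigma_display (@open (cadlag R d))) (cadlag R d) <<s @open (cadlag R d) >>
  (@sigma_algebra0 _ setT _) (@sigma_algebraC _ _)
  (@sigma_algebra_bigcup _ setT _).

End skorohod.

Section functionals.
Context {R : realType} {d : nat}.
Variable N : 'rV[R]_d -> R.
Implicit Types y : cadlag R d.
Local Open Scope ereal_scope.

Definition sup_norm y : \bar R := ereal_sup (range (fun t => (N (y t))%:E)).

Definition D0 : set (cadlag R d) :=
  [set y : cadlag R d | (N (y t) @[t --> +oo%R] --> (0 : R)%R) /\
                         (N (y t) @[t --> -oo%R] --> (0 : R)%R)].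

Definition Dalpha (alpha : R) : set (cadlag R d) :=
  [set y : cadlag R d |
    \int[lebesgue_measure]_(t in [set: R]) ((N (y t)) `^ alpha)%:E < +oo].

Definition exceed y : \bar R :=
  \int[lebesgue_measure]_(t in [set: R]) (\1_[set s : R | (1 < N (y s))%R] t)%:E.

(* y / y^*; the value when y^* is 0 or +oo is the null function *)
Definition normalize y : cadlag R d := cadlag_scale (fine (sup_norm y))^-1 y.

Definition separated0 (A : set (cadlag R d)) : Prop :=
  exists a b : R, (a <= b)%R /\
    0 < ereal_inf [set ereal_sup [set (N (y t))%:E | t in `[a, b] ] | y in A].

Definition boundedly_finite (mu : set (cadlag R d) -> \bar R) : Prop :=
  mu [set cadlag0] = 0 /\
  forall A, measurable A -> separated0 A -> mu A < +oo.

Definition exceed0 : set (cadlag R d) :=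
  [set y : cadlag R d | (1 < N (y 0%R))%R].

Definition tail_measure (alpha : R) (nu : {measure set (cadlag R d) -> \bar R})
    : Prop :=
  [/\ boundedly_finite nu, nu [set cadlag0] = 0, nu exceed0 = 1 &
    forall (t : R) A, (0 < t)%R -> measurable A ->
      nu [set cadlag_scale t y | y in A] = (t `^ (- alpha))%:E * nu A].

Definition shift_invariant (nu : {measure set (cadlag R d) -> \bar R}) : Prop :=
  forall (t : R) A, measurable A -> nu (cadlag_shift t @^-1` A) = nu A.

Definition tail_process (nu : {measure set (cadlag R d) -> \bar R})
    (dO : measure_display) (Omega : measurableType dO) (P : probability Omega R)
    (Y : {mfun Omega >-> cadlag R d}) : Prop :=
  forall A, measurable A -> distribution P Y A = nu (A `&` exceed0).

(* The measure E[delta_X] takes the value E[delta_X(A)] at a Borel set A. *)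
Definition moving_shift_rep (alpha : R)
    (nu : {measure set (cadlag R d) -> \bar R}) (theta : R)
    (dO : measure_display) (Omega : measurableType dO) (P : probability Omega R)
    (Q : {mfun Omega >-> cadlag R d}) : Prop :=
  [/\ (0 < theta)%R, P [set w | sup_norm (Q w) = 1] = 1 &
    forall A, measurable A ->
      nu A = theta%:E *
        \int[lebesgue_measure]_(t in [set: R])
        \int[lebesgue_measure]_(u in `]0%R, +oo[ )
          ((\int[P]_w \d_(cadlag_scale u (cadlag_shift t (Q w))) A) *
           (alpha * u `^ (- alpha - 1))%:E)].

(* theta^-1 E[delta_{Y / Y^*} / E(Y)], evaluated at A; inversion in \bar R is
   such that (+oo)^-1 = 0 and 0^-1 = +oo. *)
Definition spectral_law (theta : R)
    (dO : measure_display) (Omega : measurableType dO) (P : probability Omega R)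
    (Y : {mfun Omega >-> cadlag R d}) (A : set (cadlag R d)) : \bar R :=
  (theta^-1)%:E * \int[P]_w ((exceed (Y w))^-1 * \d_(normalize (Y w)) A).

End functionals.

(* Main.v *)
(* Write E(y) for [exceed N y], G for [exceed0 N], B^s for the shift and y^* for
   [sup_norm N y].

   Shift invariance of nu gives the symmetric mass transport identity
     int h(y) (int k(B^s y) ds) nu(dy) = int k(y) (int h(B^s y) ds) nu(dy)
   for nonnegative h and k.  Assume E(Y) < oo almost surely and take k = 1_G / E,
   so that int k(B^s y) ds = 1{y^* > 1} for nu-almost every y.
   - If h is the indicator of an exceedance of 1 during the time interval ]0, 1[,
     then the identity bounds int k(y) (int h(B^s y) ds) nu(dy) by nu{h = 1}, which
     is finite.  Hence E[1 / E(Y)] < oo, and almost every path exceeds level 1 only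
     on a bounded set of times; by homogeneity this holds for every level, so that
     nu is carried by D_0.
   - If h(y) is the mass of {u : u y / y^* \in A} under alpha u^(-alpha-1) du, then
     the identity turns the right-hand side of the moving shift representation
     with the announced theta and Q into int_{y^* > 1} h(y) nu(dy), which is nu(A)
     by homogeneity.
   Conversely, integrating 1_G and 1_G(y) 1_A(y / y^* ) / E(y) against a moving
   shift representation gives, respectively, 1 = theta E[int |Q_t|^alpha dt], so
   that Q belongs to D_alpha, and the values of theta and of the law of Q on
   shift-invariant sets.  The other implications follow from the fact that E is
   finite on D_0 and on D_alpha. *)
Require Import Defs.
From HB Require Import structures.
From mathcomp Require Import all_boot all_order all_algebra.
From mathcomp Require Import all_classical all_reals all_analysis.
From mathcomp Require Import measurable_realfun ring lra.
Import Order.TTheory GRing.Theory Num.Theory.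
Import numFieldNormedType.Exports.

Set Implicit Arguments.
Unset Strict Implicit.
Unset Printing Implicit Defensive.

Local Open Scope classical_set_scope.
Local Open Scope ring_scope.

(** * Norms on row vectors and the J1 topology *)

(** The weight 1_G / E spreads a unit mass uniformly over the times at which a path exceeds 1, so
    that each orbit that passes level 1 is counted exactly once. No measurable choice of a
    particular time, such as that of a maximum, is then required, and the origin of the resulting Q
    is a uniformly chosen exceedance time.

    A representing Q is not unique: B^T Q represents the same measure for every random time T,
    because Lebesgue measure is translation invariant. The announced law can therefore hold for
    every representing Q only on shift-invariant sets, and on all Borel sets for one suitable Q; the
    conclusion has one part for each.

    Exchanging integrals rests on sigma-finiteness of nu and on joint measurability of (t, y) -> B^t
    y and (u, y) -> u y for the product sigma-field. Under the finiteness of E(Y), the paths with E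
    = +oo or with y^* equal to 0 or +oo form null sets, so the identities that could meet a default
    value are proved off an exceptional set. *)

Section norms.
Context {R : realType} {d : nat} (N : 'rV[R]_d -> R) (N_norm : is_norm N).

Lemma is_norm0 : N 0 = 0.
Proof. by rewrite -(scale0r 0) (is_normZ N_norm) normr0 mul0r. Qed.

Lemma is_normN x : N (- x) = N x.
Proof. by rewrite -scaleN1r (is_normZ N_norm) normrN1 mul1r. Qed.

Lemma is_norm_ge0 x : 0 <= N x.
Proof.
have := is_norm_triangle N_norm x (- x).
by rewrite subrr is_norm0 is_normN; lra.
Qed.

Lemma is_norm_dist x y : `|N x - N y| <= N (x - y).
Proof.
rewrite ler_norml; have := is_norm_triangle N_norm (x - y) y.
have := is_norm_triangle N_norm (y - x) x.
rewrite !subrK -opprB is_normN => ? ?; apply/andP; split; lra.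
Qed.

Lemma is_norm_sum (I : Type) (r : seq I) (F : I -> 'rV[R]_d) :
  N (\sum_(i <- r) F i) <= \sum_(i <- r) N (F i).
Proof.
elim: r => [|i r IH]; first by rewrite !big_nil is_norm0.
by rewrite !big_cons (le_trans (is_norm_triangle N_norm _ _))// lerD2l.
Qed.

(** Expanding x - y in the canonical basis bounds N by the coordinatewise distance, which is what
    [ball] controls. The summand 1 in the constant makes it positive at once. *)
Lemma is_norm_ball :
  exists2 C, 0 < C &
    forall x y e, ball x e y -> `|N x - N y| <= C * e.
Proof.
exists (1 + \sum_(j < d) N (delta_mx 0 j)).
  by rewrite ltr_pwDl// sumr_ge0// => j _; exact: is_norm_ge0.
move=> x y e xy; have e0 := xy.1.
apply: (le_trans (is_norm_dist _ _)).
rewrite [x - y]row_sum_delta mulrDl mul1r.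
apply: (le_trans (is_norm_sum _ _)).
rewrite -[leLHS]add0r lerD ?(ltW e0)// mulr_suml ler_sum// => j _.
rewrite (is_normZ N_norm) mulrC ler_wpM2l ?is_norm_ge0// !mxE.
by have := xy.2 ord0 j; rewrite /ball/= => /ltW.
Qed.

Lemma is_norm_cvg (T : Type) (F : set_system T) (FF : Filter F)
    (f : T -> 'rV[R]_d) (l : 'rV[R]_d) :
  f x @[x --> F] --> l -> N (f x) @[x --> F] --> N l.
Proof.
move=> /cvg_ballP fl; have [C C0 NC] := is_norm_ball.
apply/cvgrPdist_lt => e e0.
have e'0 : 0 < e / (C + C) by rewrite divr_gt0// addr_gt0.
apply: filterS (fl _ e'0) => x /(NC _ _ _) /le_lt_trans; apply.
rewrite [ltLHS](_ : _ = e / 2); first by rewrite ltr_pdivrMr// mulr2n mulrDr mulr1 ltrDl.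
by field; rewrite ?gt_eqF//; lra.
Qed.

End norms.

Section j1_topology.
Context {R : realType} {d : nat}.
Implicit Types (f g h : cadlag R d) (U : set (cadlag R d)).

(** Time changes compose. The second window is [K + e1] because the first change can carry points of
    [-K, K] that far. *)
Lemma j1_nbhd_trans f g h K e1 e2 :
  j1_nbhd f K e1 g -> j1_nbhd g (K + e1) e2 h -> j1_nbhd f K (e1 + e2) h.
Proof.
move=> [lam [[lamm lams] lamP]] [mu [[mum mus] muP]].
exists (mu \o lam); split.
  split=> [s t st|t]; first exact/mum/lamm.
  by have [s <-] := mus t; have [r <-] := lams s; exists r.
move=> t tK; have [lt1 b1] := lamP t tK.
have [|lt2 b2] := muP (lam t).
  by move: lt1; rewrite ltr_norml => /andP[? ?]; move: tK => /andP[? ?]; apply/andP; split; lra.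
split; last exact: ball_triangle b1 b2.
rewrite /= -(subrK (lam t) (mu _)) -addrA addrC.
by rewrite (le_lt_trans (ler_normD _ _))// ltrD.
Qed.

Lemma j1_nbhd_refl f K e : 0 < e -> j1_nbhd f K e f.
Proof.
move=> e0; exists id; split; first by split=> // t; exists t.
by move=> t _; rewrite subrr normr0; split => //; exact: ballxx.
Qed.

(** V is the interior of the neighbourhood; it is open because a radius can be split into two halves
    by [j1_nbhd_trans]. *)
Lemma open_j1_nbhd f K e : 0 < e ->
  exists V, [/\ open V, V f & V `<=` j1_nbhd f K e].
Proof.
move=> e0.
exists [set g | exists K' e', 0 < e' /\ j1_nbhd g K' e' `<=` j1_nbhd f K e].
split; last first.
- by move=> g [K' [e' [e'0]]]; apply; exact: j1_nbhd_refl.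
- by exists K, e; split.
move=> g [K' [e' [e'0 gS]]]; exists K', (e' / 2); split; first by rewrite divr_gt0.
move=> h gh; exists (K' + e' / 2), (e' / 2); split; first by rewrite divr_gt0.
move=> k hk; apply: gS; rewrite (_ : e' = e' / 2 + e' / 2); last by field.
exact: j1_nbhd_trans gh hk.
Qed.

End j1_topology.

Section local_bound.
Context {R : realType} {d : nat}.

(** The two one-sided limits bound the path near each time, and compactness of [-K, K] makes the
    bound uniform. *)
Lemma cadlag_bounded (y : cadlag R d) (K : R) :
  exists2 M, 0 < M & forall t, - K <= t <= K -> ball 0 M (y t).
Proof.
have : \forall M \near +oo, `[- K, K] `<=` [set t | ball 0 M (y t)].
  apply: (proj1 (compact_near_coveringP _)) (@segment_compact _ (- K) K) _ _ _ _ _ => // t _.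
  have [yr [l yl]] := cadlagP y t.
  have bnd (v : 'rV[R]_d) : exists2 M, 0 < M & ball 0 M v.
    exists (1 + \sum_(j < d) `|v ord0 j|); first by rewrite ltr_pwDl// sumr_ge0.
    split=> [|i j]; first by rewrite ltr_pwDl// sumr_ge0.
    rewrite ord1 !mxE /ball/= sub0r normrN (bigD1 j)//= addrCA.
    by rewrite ltrDl ltr_pwDl// sumr_ge0.
  have [M1 M10 bM1] := bnd (y t).
  have [M2 M20 bM2] := bnd l.
  move/cvg_ballP : yr => /(_ 1 ltr01) yr.
  move/cvg_ballP : yl => /(_ 1 ltr01) yl.
  have bd : \forall s \near t, ball 0 (M1 + M2 + 1) (y s).
    rewrite /at_right /at_left /within /= in yr yl.
    near=> s; have [st|ts|->] := ltgtP s t.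
    - apply: (@le_ball _ _ _ (M2 + 1)); first by lra.
      apply: ball_triangle bM2 _.
      by move: st; near: s.
    - apply: (@le_ball _ _ _ (M1 + 1)); first by lra.
      apply: ball_triangle bM1 _.
      by move: ts; near: s.
    - by apply: le_ball bM1; lra.
  exists ([set s | ball 0 (M1 + M2 + 1) (y s)], [set M | M1 + M2 + 1 <= M]).
    by split => //; apply: nbhs_pinfty_ge; rewrite num_real.
  by move=> [s M] [b leM]; have : ball 0 (M1 + M2 + 1) (y s) := b; exact/le_ball/leM.
move=> near_bound.
have : \forall M \near +oo, 0 < M /\ `[- K, K] `<=` [set t | ball 0 M (y t)].
  near=> M; split; last by near: M.
  by near: M; apply: nbhs_pinfty_gt; rewrite num_real.
move=> /filter_ex[M [M0 MP]]; exists M; first by [].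
move=> t tK; apply: MP; rewrite /= in_itv/=; exact: tK.
Unshelve. all: by end_near. Qed.

End local_bound.

(** * Measurability of shifts, scalings and path values *)

Section measurability.
Context {R : realType} {d : nat}.
Implicit Types (y g : cadlag R d) (U : set (cadlag R d)).

Lemma open_cadlag_measurable U : open U -> measurable U.
Proof. by move=> Uo; exact: sub_sigma_algebra. Qed.

(* Joint measurability only needs second countability of the time line: an open
   subset of R x D is a countable union of products of a rational interval with an
   open set; separability of D is not needed. *)
Lemma measurable_time_action (F : measurableTypeR R -> cadlag R d -> cadlag R d) :
  (forall t y U, open U -> U (F t y) -> exists e K, 0 < e /\
     forall s g, `|s - t| < e -> j1_nbhd y K e g -> U (F s g)) ->
  measurable_fun setT (fun p : measurableTypeR R * cadlag R d => F p.1 p.2).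
Proof.
move=> FU; apply: (@measurability _ _ _ _ _ _ (@open (cadlag R d))) => // _ [U Uo <-].
pose V (p q : rat) := \bigcup_(W in [set W : set (cadlag R d) | open W /\
  forall s g, ratr p < s < ratr q -> W g -> U (F s g)]) W.
rewrite [X in measurable X](_ : _ = \bigcup_(p : rat) \bigcup_(q : rat)
    (([set t : measurableTypeR R | ratr p < t < ratr q] `*` V p q))); last first.
  apply/seteqP; split=> [[t y] [_ /= Uty]|[t y] [p _ [q _ [/= tpq]]]]; last first.
    by move=> [W [_ WU] Wy]; split => //; exact: WU.
  have [e [K [e0 eU]]] := FU _ _ _ Uo Uty.
  have [|p] := @rat_in_itvoo R (t - e) t; first by rewrite ltrBlDr ltrDl.
  rewrite in_itv/= => /andP[ep pt].
  have [|q] := @rat_in_itvoo R t (t + e); first by rewrite ltrDl.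
  rewrite in_itv/= => /andP[tq qe].
  exists p => //; exists q => //; split; first by rewrite /= pt tq.
  have [W [Wo Wy WK]] := open_j1_nbhd y K e0.
  exists W => //; split => // s g /andP[ps sq] /WK; apply: eU.
  by rewrite ltr_norml; apply/andP; split; lra.
apply: bigcupT_measurable_rat => p; apply: bigcupT_measurable_rat => q.
apply: measurableX.
  by rewrite [X in measurable X](_ : _ = `]ratr p, ratr q[%classic).
by apply: open_cadlag_measurable; apply: bigcup_open => W [].
Qed.

Lemma measurable_cadlag_shift : measurable_fun setT
  (fun p : measurableTypeR R * cadlag R d => cadlag_shift p.1 p.2).
Proof.
apply: measurable_time_action => t y U Uo /Uo[K [e [e0 KU]]].
exists (e / 2), (K + `|t|); split; first by rewrite divr_gt0.
move=> s g st [lam [[lamm lams] lamP]]; apply: KU.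
(* This change matches B^t y with B^s g. Its displacement is that of [lam] plus s - t, hence the two
   halves of e, and r - t lies in the window enlarged by |t|. *)
exists (fun r => lam (r - t) + s); split.
  split=> [a b ab|r]; first by rewrite ltrD2r lamm// ltrD2r.
  by have [a ar] := lams (r - s); exists (a + t); rewrite addrK ar subrK.
move=> r /andP[Kr rK].
have [|lt b] := lamP (r - t).
  by move: (ler_norm t) (ler_norm (- t)); rewrite normrN => ? ?; apply/andP; split; lra.
split; last by rewrite /= addrK; apply: le_ball b; lra.
rewrite (_ : _ - r = (lam (r - t) - (r - t)) + (s - t)); last by ring.
by rewrite (le_lt_trans (ler_normD _ _))// [ltRHS](_ : _ = e / 2 + e / 2); [exact: ltrD|field].
Qed.

Lemma measurable_cadlag_scale : measurable_fun setT
  (fun p : measurableTypeR R * cadlag R d => cadlag_scale p.1 p.2).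
Proof.
apply: measurable_time_action => t y U Uo /Uo[K [e [e0 KU]]].
have [M M0 bM] := cadlag_bounded y K.
pose c := M + `|t| + 1.
have c0 : 0 < c by rewrite /c; have := normr_ge0 t; lra.
(* Write t y - s g = (t - s) y + s (y - g). With |s| <= |t| + 1, granted by the minimum with 1, it
   is bounded by e' M + (|t| + 1) e' = e' c <= e / 2. The minimum with e serves the time change. *)
pose e' := Num.min 1 (Num.min e (e / (2 * c))).
have e'0 : 0 < e' by rewrite !lt_min ltr01 e0 divr_gt0// mulr_gt0.
have e'1 : e' <= 1 by rewrite ge_min lexx.
have e'e : e' <= e by rewrite !ge_min lexx orbT.
have e'c : e' * c <= e / 2.
  rewrite (@le_trans _ _ (e / (2 * c) * c))//.
    by rewrite ler_wpM2r ?(ltW c0)// !ge_min lexx !orbT.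
  by rewrite le_eqVlt; apply/orP; left; apply/eqP; field; rewrite gt_eqF.
exists e', K; split => // s g st [lam [lamP lamg]].
apply: KU; exists lam; split => // r rK.
have [lt [_ b]] := lamg r rK; split; first exact: lt_le_trans e'e.
split => // i j; have [_ /(_ i j)] := bM r rK; move: (b i j).
rewrite !mxE /ball/= sub0r normrN => b1 b2.
rewrite (_ : _ - _ = (t - s) * cadlag_fun y r i j +
  s * (cadlag_fun y r i j - g (lam r) i j)); last by ring.
rewrite (le_lt_trans (ler_normD _ _))// !normrM distrC.
have s1 : `|s| <= `|t| + 1.
  rewrite -(subrK t s) addrC (le_trans (ler_normD _ _))// lerD2l (le_trans _ e'1)//.
  exact: ltW.
have : `|s - t| * `|cadlag_fun y r i j| <= e' * M.
  by apply: ler_pM => //; exact: ltW.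
have : `|s| * `|cadlag_fun y r i j - g (lam r) i j| <= (`|t| + 1) * e'.
  by apply: ler_pM => //; exact: ltW.
move: e'c; rewrite /c !mulrDr mulr1 => ? ? ?; lra.
Qed.

End measurability.

Section norm_functionals.
Context {R : realType} {d : nat} (N : 'rV[R]_d -> R) (N_norm : is_norm N).
Implicit Types (y g : cadlag R d).

(** Openness of the time set absorbs the time change and strictness of the inequality absorbs the
    change of value. At a single fixed time this would fail, since evaluation is not J1-continuous
    at a jump. *)
Lemma open_exceedance (O : set R) (c : R) : open O ->
  open [set y : cadlag R d | exists2 s, O s & c < N (y s)].
Proof.
move=> Oo; suff : j1_open [set y : cadlag R d | exists2 s, O s & c < N (y s)] by [].
move=> y [s Os cs]; have [C C0 NC] := is_norm_ball N_norm.
have /nbhs_ballP[e e0 eO] : nbhs s O by exact: open_nbhs_nbhs.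
pose e' := Num.min e ((N (y s) - c) / (2 * C)).
have e'0 : 0 < e' by rewrite lt_min e0/= divr_gt0 ?subr_gt0// mulr_gt0.
exists `|s|, e'; split=> // g [lam [_ lamg]].
have [|ls b] := lamg s.
  by rewrite -ler_norml.
exists (lam s).
  by apply: eO; rewrite /ball/= distrC (lt_le_trans ls)// ge_min lexx.
have := NC _ _ _ b.
have : C * e' <= (N (y s) - c) / 2.
  rewrite (@le_trans _ _ (C * ((N (y s) - c) / (2 * C))))//.
    by rewrite ler_wpM2l ?(ltW C0)// ge_min lexx orbT.
  by rewrite le_eqVlt; apply/orP; left; apply/eqP; field; rewrite gt_eqF.
by rewrite ler_norml => ? /andP[_ ?]; lra.
Qed.

Lemma measurable_exceedance (O : set R) (c : R) : open O ->
  measurable [set y : cadlag R d | exists2 s, O s & c < N (y s)].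
Proof. by move=> Oo; apply: open_cadlag_measurable; exact: open_exceedance. Qed.

Lemma cadlag_norm_right y t : N (y s) @[s --> t^'+] --> N (y t).
Proof. by apply: (is_norm_cvg N_norm); have [] := cadlagP y t. Qed.

Lemma near_right_exceed y t c : c < N (y t) ->
  exists2 e, 0 < e & forall s, t <= s < t + e -> c < N (y s).
Proof.
move=> ct; have /cvgrPdist_lt/(_ (N (y t) - c)) := @cadlag_norm_right y t.
rewrite subr_gt0 => /(_ ct)[e /= e0 eP]; exists e => // s /andP[].
rewrite le_eqVlt => /predU1P[<-//|ts st].
have : `|N (y t) - N (y s)| < N (y t) - c.
  by apply: eP => //; rewrite /ball/= ltr_norml; apply/andP; split; lra.
by rewrite ltr_norml => /andP[_]; lra.
Qed.

(** Right continuity recovers the value at t from exceedances in the open windows ]t, t + 1/(n+1)[;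
    the margin 1/(k+1) keeps the inequality strict in the limit. *)
Lemma measurable_norm_eval t :
  measurable_fun setT (fun y : cadlag R d => N (y t)).
Proof.
move=> mT; apply: (measurability _ (RGenOInfty.measurableE R)) => //.
move=> /= _ [_ [c ->] <-]; rewrite setTI preimage_itvoy.
rewrite [X in measurable X](_ : _ = \bigcup_k \bigcap_n
  [set y : cadlag R d | exists2 s, `]t, t + n.+1%:R^-1[%classic s &
     c + k.+1%:R^-1 < N (y s)]).
  apply: bigcupT_measurable => k; apply: bigcapT_measurable => n.
  by apply: measurable_exceedance; exact: interval_open.
apply/seteqP; split=> y /= => [cy|[k _ yk]].
  have cy0 : 0 < N (y t) - c by rewrite subr_gt0.
  have [k kP] : exists k, k.+1%:R^-1 < N (y t) - c.
    by have /filter_ex[k] := near_infty_natSinv_lt (PosNum cy0); exists k.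
  exists k => // n _; set r := k.+1%:R^-1 in kP *.
  have [|e e0 eP] := @near_right_exceed y t (c + r); first by lra.
  pose m := Num.min e n.+1%:R^-1.
  have m0 : 0 < m by rewrite lt_min e0 invr_gt0 ltr0n.
  exists (t + m / 2); last first.
    apply: eP; apply/andP; split; first by lra.
    have : m <= e by rewrite ge_min lexx.
    lra.
  have : m <= n.+1%:R^-1 by rewrite ge_min lexx orbT.
  rewrite in_itv/=; set q := n.+1%:R^-1 => ?; apply/andP; split; lra.
apply: (@lt_le_trans _ _ (c + k.+1%:R^-1)); first by rewrite ltrDl invr_gt0.
rewrite leNgt; apply/negP => yc.
have /cvgrPdist_lt/(_ (c + k.+1%:R^-1 - N (y t))) := @cadlag_norm_right y t.
rewrite subr_gt0 => /(_ yc)[e /= e0 eP].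
have [n nP] : exists n, n.+1%:R^-1 < e.
  by have /filter_ex[n] := near_infty_natSinv_lt (PosNum e0); exists n.
have [s] := yk n Logic.I; rewrite /= in_itv/=.
move: nP; set q := n.+1%:R^-1 => nP /andP[ts stn].
have : `|N (y t) - N (y s)| < c + k.+1%:R^-1 - N (y t).
  by apply: eP => //; rewrite /ball/= ltr_norml; apply/andP; split; lra.
by set r := k.+1%:R^-1; rewrite ltr_norml => /andP[? ?] ?; lra.
Qed.

(** The value at t is the value at 0 of B^(-t) y, so joint measurability is inherited from the
    shift. *)
Lemma measurable_norm_path :
  measurable_fun setT (fun p : measurableTypeR R * cadlag R d => N (p.2 p.1)).
Proof.
rewrite [X in measurable_fun _ X](_ : _ =
    (fun y => N (y 0)) \o (fun p : measurableTypeR R * cadlag R d =>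
       cadlag_shift p.1 p.2) \o (fun p => (- p.1, p.2))); last first.
  by apply/funext => -[t y] /=; rewrite sub0r opprK.
apply: measurableT_comp; last first.
  apply/measurable_fun_pairP; split => /=; last exact: measurable_snd.
  by apply: measurable_funN; exact: measurable_fst.
by apply: measurableT_comp; [exact: measurable_norm_eval|exact: measurable_cadlag_shift].
Qed.

Lemma measurable_normT y : measurable_fun setT (fun t : measurableTypeR R => N (y t)).
Proof. exact: measurableT_comp measurable_norm_path (measurable_pair2 y). Qed.

End norm_functionals.

(** * Lebesgue integrals: densities, affine substitutions, powers *)

Section image_density.
Local Open Scope ereal_scope.
Context d1 d2 (X : measurableType d1) (Z : measurableType d2) (R : realType).
Variables (phi : X -> Z) (w : X -> R).
Hypotheses (mphi : measurable_fun setT phi) (mw : measurable_fun setT w).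
Hypothesis w0 : forall x, (0 <= w x)%R.
Variables (mu : {measure set X -> \bar R}) (nu : {measure set Z -> \bar R}).
Hypothesis nuE : forall A, measurable A ->
  nu A = \int[mu]_x ((\1_A (phi x))%:E * (w x)%:E).

Import HBNNSimple.

(** Here nu is the image under [phi] of w mu; the identity passes from sets to simple functions and
    then to monotone limits. Affine substitutions, shifts, scalings, the law of Y and the moving
    shift representation are all instances. *)
Lemma integral_image_density (f : Z -> \bar R) :
  measurable_fun setT f -> (forall z, 0 <= f z) ->
  \int[nu]_z f z = \int[mu]_x (f (phi x) * (w x)%:E).
Proof.
move=> mf f0; pose h := nnsfun_approx measurableT mf.
have hf z : EFin (h n z) @[n --> \oo] --> f z.
  by apply: cvg_nnsfun_approx => // *; exact: f0.
have nd z : {homo (fun n => (h n z)%:E) : m n / (m <= n)%N >-> m <= n}.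
  by move=> m n mn; rewrite lee_fin; exact/lefP/nd_nnsfun_approx.
have mh n : measurable_fun setT (fun x => (h n (phi x))%:E * (w x)%:E).
  by apply: emeasurable_funM; apply/measurable_EFinP => //; exact: measurableT_comp.
transitivity (limn (fun n => \int[nu]_z (h n z)%:E)).
  rewrite -monotone_convergence//.
  - by apply: eq_integral => z _; apply/esym/cvg_lim.
  - by move=> n; apply/measurable_EFinP.
  - by move=> n z _; rewrite lee_fin.
transitivity (limn (fun n => \int[mu]_x ((h n (phi x))%:E * (w x)%:E))); last first.
  rewrite -monotone_convergence//.
  - by apply: eq_integral => x _; apply/cvg_lim => //; exact: cvgeZr.
  - by move=> n x _; rewrite mule_ge0// lee_fin.
  - by move=> x _ m n mn; rewrite lee_wpmul2r ?lee_fin//; have := nd (phi x) _ _ mn; rewrite lee_fin.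
congr (limn _); apply/funext => n.
have mind r : measurable (h n @^-1` [set r]) by [].
transitivity (\sum_(r \in range (h n)) r%:E * nu (h n @^-1` [set r])).
  under eq_integral do rewrite fimfunE -fsumEFin//.
  rewrite ge0_integral_fsum//; last 2 first.
  - by move=> y; exact/measurable_EFinP/measurable_funM.
  - by move=> y x _; rewrite nnfun_muleindic_ge0.
  apply: eq_fsbigr => r _; rewrite integralZl_indic_nnsfun// integral_indic//=.
  by rewrite setIT.
transitivity (\int[mu]_x (\sum_(r \in range (h n))
    r%:E * ((\1_(h n @^-1` [set r]) (phi x))%:E * (w x)%:E))).
  rewrite ge0_integral_fsum//; last 2 first.
  - move=> r; apply: emeasurable_funM => //; apply: emeasurable_funM.
      by apply/measurable_EFinP; apply: measurableT_comp.
    exact/measurable_EFinP.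
  - move=> r x _; rewrite muleA; apply: mule_ge0; last by rewrite lee_fin.
    by rewrite -EFinM; exact: nnfun_muleindic_ge0.
  apply: eq_fsbigr => r /[!inE] -[z _ <-]; rewrite ge0_integralZl//.
  - by rewrite nuE.
  - apply: emeasurable_funM; apply/measurable_EFinP => //.
    exact: measurableT_comp.
  - by move=> x _; rewrite mule_ge0// lee_fin.
  - by rewrite lee_fin.
apply: eq_integral => x _.
rewrite fimfunE -fsumEFin// ge0_mule_fsuml; last first.
  by move=> y; exact: nnfun_muleindic_ge0.
by apply: eq_fsbigr => r _; rewrite EFinM muleA.
Qed.

End image_density.

Section lebesgue_affine.
Local Open Scope ereal_scope.
Context {R : realType}.
Local Notation mu := (@lebesgue_measure R).

(** By uniqueness of Lebesgue measure it suffices to test the intervals ]x, y]; a negative a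
    exchanges their ends. *)
Lemma lebesgue_measure_affine (a b : R) (A : set (measurableTypeR R)) : (a != 0)%R ->
  measurable A -> mu A = `|a|%:E * mu ((fun s => a * s + b)%R @^-1` A).
Proof.
move=> a0 mA.
have mphi : measurable_fun setT ((fun s => a * s + b)%R : measurableTypeR R -> measurableTypeR R).
  by apply: measurable_funD => //; exact: measurable_funM.
have na0 : (0 < `|a|)%R by rewrite normr_gt0.
apply: (@lebesgue_measure_unique R (mscale (NngNum (normr_ge0 a)) (pushforward mu
  ((fun s => a * s + b)%R : measurableTypeR R -> measurableTypeR R)))) => //.
move=> _ [[x y]] _ <-; rewrite -[RHS]/(`|a|%:E * mu ((fun s => a * s + b)%R @^-1` `]x, y]%classic)).
have [a_gt0|a_lt0] : (0 < a \/ a < 0)%R by apply/orP; rewrite -neq_lt eq_sym.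
- rewrite (_ : _ @^-1` _ = `](x - b) / a, (y - b) / a]%classic)%R; last first.
    apply/seteqP; split => s /=; rewrite !in_itv/= ltr_pdivrMr// ler_pdivlMr//;
    by rewrite ltrBlDr lerBrDr mulrC.
  rewrite !lebesgue_measure_itv/= !lte_fin ltr_pM2r ?invr_gt0// ltrD2r.
  case: ifPn => _; rewrite ?mule0// -!EFinD -EFinM; congr EFin.
  by rewrite gtr0_norm//; field.
- rewrite (_ : _ @^-1` _ = `[(y - b) / a, (x - b) / a[%classic)%R; last first.
    apply/seteqP; split => s /=; rewrite !in_itv/= ltr_ndivlMr// ler_ndivrMr//;
    by rewrite ltrBlDr lerBrDr mulrC andbC.
  rewrite !lebesgue_measure_itv/= !lte_fin ltr_nM2r ?invr_lt0// ltrD2r.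
  case: ifPn => _; rewrite ?mule0// -!EFinD -EFinM; congr EFin.
  by rewrite ltr0_norm//; field.
Qed.

Lemma integral_lebesgue_affine (a b : R) (f : R -> \bar R) : (a != 0)%R ->
  measurable_fun setT f -> (forall s, 0 <= f s) ->
  \int[mu]_s f s = `|a|%:E * \int[mu]_s f (a * s + b)%R.
Proof.
move=> a0 mf f0.
have mphi : measurable_fun setT ((fun s => a * s + b)%R : measurableTypeR R -> measurableTypeR R).
  by apply: measurable_funD => //; exact: measurable_funM.
rewrite (@integral_image_density _ _ _ _ R ((fun s => a * s + b)%R : measurableTypeR R -> measurableTypeR R) (cst `|a|%R) _ _ _ mu mu)//=.
  rewrite ge0_integralZr//; first by rewrite muleC.
  exact: measurableT_comp.
move=> A mA; rewrite (lebesgue_measure_affine b a0)//.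
rewrite ge0_integralZr//; last first.
- have mA1 : measurable_fun setT (fun x : measurableTypeR R => (\1_A x : R)%:E).
    by apply/measurable_EFinP; exact: measurable_indic.
  exact: (measurableT_comp mA1 mphi).
rewrite muleC; congr (_ * _).
rewrite -[X in mu X]setIT -integral_indic//.
rewrite -[X in measurable X]setTI; exact: mphi.
Qed.

End lebesgue_affine.

Section power_integrals.
Local Open Scope ereal_scope.
Context {R : realType}.
Variables (alpha : R) (alpha_gt0 : (0 < alpha)%R).
Local Notation mu := (@lebesgue_measure R).

Lemma integral_power (b c x y : R) : b != 0%R -> (0 < x)%R -> (x < y)%R ->
  \int[mu]_(v in `[x, y]) (c * v `^ (b - 1))%:E = (c / b * (y `^ b - x `^ b))%:E.
Proof.
move=> b0 x0 xy.
have cont e v : (0 < v)%R -> {for v, continuous (fun u : R => u `^ e)%R}.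
  move=> v0; apply: differentiable_continuous; apply/derivable1_diffP.
  by apply: derivable_powR; rewrite in_itv/= v0.
rewrite (@continuous_FTC2 R _ (fun v => c / b * v `^ b)%R)//.
- by rewrite -EFinB; congr EFin; rewrite mulrBr.
- apply: continuous_in_subspaceT => v; rewrite inE/= in_itv/= => /andP[xv _].
  apply: cvgM; first exact: cvg_cst.
  exact/cont/(lt_le_trans x0).
- split.
  + move=> v; rewrite in_itv/= => /andP[xv _].
    apply: derivableM => //; apply: derivable_powR; rewrite in_itv/= andbT.
    exact: lt_trans xv.
  + apply: cvg_at_right_filter; apply: cvgM; first exact: cvg_cst.
    exact: cont.
  + apply: cvg_at_left_filter; apply: cvgM; first exact: cvg_cst.
    exact/cont/(lt_trans x0).
- move=> v; rewrite in_itv/= => /andP[xv _].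
  have v0 := lt_trans x0 xv.
  rewrite derive1E deriveM//; last by apply: ex_derive; exact: is_derive1_powR.
  rewrite derive_cst scaler0 addr0 -derive1E powR_derive1 ?in_itv/= ?v0//.
  by rewrite /GRing.scale/=; field.
Qed.


Let cvg_1subpowR :
  (1 - n.+2%:R^-1 `^ alpha : R)%R%:E @[n --> \oo] --> (1 : \bar R).
Proof.
suff : (1 - n.+2%:R^-1 `^ alpha : R)%R%:E @[n --> \oo] --> ((1 - 0)%R%:E : \bar R).
  by rewrite subr0.
apply: cvg_EFin; first by apply: nearW.
apply: cvgB; first exact: cvg_cst.
apply: (cvg_comp _ _ _ (powR_cvg0 alpha_gt0)).
move=> A /= [e /= e0 eA]; near=> n.
apply: eA => /=; rewrite ?invr_gt0// sub0r normrN gtr0_norm ?invr_gt0//.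
apply: (@lt_trans _ _ n.+1%:R^-1%R); first by rewrite ltf_pV2 ?posrE// ltr_nat.
by near: n; exact: (near_infty_natSinv_lt (PosNum e0)).
Unshelve. all: by end_near. Qed.

Lemma integral_power01 : \int[mu]_(v in `]0%R, 1%R]) (alpha * v `^ (alpha - 1))%:E = 1.
Proof.
(* The integrand can be singular at 0, so the integral is exhausted by compact intervals. The index
   [n.+2] keeps them nondegenerate, as [integral_power] requires. *)
pose F n := `[(n.+2%:R^-1 : R)%R, 1%R]%classic.
have -> : `]0%R, 1%R]%classic = \bigcup_n F n.
  apply/seteqP; split=> v /=.
    rewrite in_itv/= => /andP[v0 v1].
    have /filter_ex[n nv] := near_infty_natSinv_lt (PosNum v0).
    exists n => //; rewrite /F/= in_itv/= v1 andbT (le_trans _ (ltW nv))//.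
    by rewrite lef_pV2 ?posrE// ler_nat.
  by move=> [n _]; rewrite /F/= !in_itv/= => /andP[nv ->]; rewrite andbT (lt_le_trans _ nv).
have cvg1 : \int[mu]_(v in F n) (alpha * v `^ (alpha - 1))%:E @[n --> \oo] -->
    \int[mu]_(v in \bigcup_n F n) (alpha * v `^ (alpha - 1))%:E.
  apply: ge0_nondecreasing_set_cvg_integral => //.
  - apply/nondecreasing_seqP => n; rewrite subsetEset => v; rewrite /F/= !in_itv/=.
    move=> /andP[nv ->]; rewrite andbT (le_trans _ nv)//.
    by rewrite lef_pV2 ?posrE// ler_nat.
  - by move=> n; exact: measurable_itv.
  - move=> n; apply/measurable_EFinP; apply: measurable_funM => //.
    by apply: measurable_funTS; exact: measurable_powR.
  - by move=> n v _; rewrite lee_fin mulr_ge0 ?powR_ge0// ltW.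
apply: (cvg_unique _ cvg1) => //.
rewrite (_ : (fun n => _) = (fun n => (1 - n.+2%:R^-1 `^ alpha)%R%:E)); last first.
  apply/funext => n; rewrite /F integral_power ?gt_eqF//; last first.
    by rewrite invf_lt1// ltr1n.
  by rewrite powR1 divff ?gt_eqF// mul1r.
exact: cvg_1subpowR.
Qed.


Lemma integral_power1y : \int[mu]_(v in `[1%R, +oo[) (alpha * v `^ (- alpha - 1))%:E = 1.
Proof.
pose F n := `[1%R : R, (n.+2%:R : R)%R]%classic.
have -> : `[1%R, +oo[%classic = \bigcup_n F n.
  apply/seteqP; split=> v /=.
    rewrite in_itv/= andbT => v1.
    exists (Num.bound v) => //; rewrite /F/= in_itv/= v1/=.
    apply/ltW; rewrite (lt_le_trans (archi_boundP (le_trans ler01 v1)))//.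
    by rewrite ler_nat ltnW.
  by move=> [n _]; rewrite /F/= !in_itv/= => /andP[-> _].
have cvg1 : \int[mu]_(v in F n) (alpha * v `^ (- alpha - 1))%:E @[n --> \oo] -->
    \int[mu]_(v in \bigcup_n F n) (alpha * v `^ (- alpha - 1))%:E.
  apply: ge0_nondecreasing_set_cvg_integral => //.
  - apply/nondecreasing_seqP => n; rewrite subsetEset => v; rewrite /F/= !in_itv/=.
    by move=> /andP[-> nv]; rewrite /= (le_trans nv)// ler_nat.
  - by move=> n; exact: measurable_itv.
  - move=> n; apply/measurable_EFinP; apply: measurable_funM => //.
    by apply: measurable_funTS; exact: measurable_powR.
  - by move=> n v _; rewrite lee_fin mulr_ge0 ?powR_ge0// ltW.
apply: (cvg_unique _ cvg1) => //.
rewrite (_ : (fun n => _) = (fun n => (1 - n.+2%:R^-1 `^ alpha)%R%:E)); last first.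
  apply/funext => n; rewrite /F integral_power ?oppr_eq0 ?gt_eqF//; last first.
    by rewrite ltr1n.
  rewrite powR1 invrN mulrN divff ?gt_eqF// mulN1r opprB powRN.
  by rewrite -powR_inv1// -[X in (1 - X)%R]powRrM mulrC powRrM powR_inv1.
exact: cvg_1subpowR.
Qed.

(** Extending the density by 0 turns integrals over ]0, +oo[ into integrals over the line, where
    affine substitution and Tonelli apply directly. *)
Definition pareto_density (u : R) : R :=
  if (0 < u)%R then (alpha * u `^ (- alpha - 1))%R else 0%R.

Lemma pareto_density_ge0 u : (0 <= pareto_density u)%R.
Proof.
by rewrite /pareto_density; case: ifPn => // _; rewrite mulr_ge0 ?powR_ge0// ltW.
Qed.

Lemma measurable_pareto_density :
  measurable_fun setT (pareto_density : measurableTypeR R -> R).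
Proof.
apply: measurable_fun_ifT => //.
- by apply: measurable_fun_ltr => //; exact: measurable_id.
- by apply: measurable_funM => //; exact: measurable_powR.
Qed.

(** Homogeneity of the Pareto measure: c (c u)^(-alpha-1) = c^(-alpha) u^(-alpha-1) under the
    substitution of c u for u. *)
Lemma integral_pareto_scale (c : R) (f : R -> \bar R) : (0 < c)%R ->
  measurable_fun setT f -> (forall u, 0 <= f u) ->
  \int[mu]_u (f (c * u)%R * (pareto_density u)%:E) =
  (c `^ alpha)%:E * \int[mu]_u (f u * (pareto_density u)%:E).
Proof.
move=> c0 mf f0.
have mfp : measurable_fun setT (fun u => f u * (pareto_density u)%:E).
  by apply: emeasurable_funM => //; apply/measurable_EFinP; exact: measurable_pareto_density.
rewrite [in RHS](@integral_lebesgue_affine _ c 0 (fun u => f u * (pareto_density u)%:E)) ?gt_eqF//; last first.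
  by move=> u; rewrite mule_ge0// lee_fin pareto_density_ge0.
rewrite gtr0_norm// muleA -EFinM -ge0_integralZl//; first last.
- by rewrite lee_fin mulr_ge0 ?powR_ge0// ltW.
- by move=> u _; rewrite mule_ge0// lee_fin pareto_density_ge0.
- by apply: (measurableT_comp mfp); apply: measurable_funD => //; exact: measurable_funM.
apply: eq_integral => u _; rewrite addr0 muleCA -EFinM; congr (_ * _%:E).
rewrite /pareto_density pmulr_rgt0//; case: ifPn => u0; last by rewrite mulr0.
rewrite powRM ?ltW// [(c `^ (_ - 1))%R]powRB; last by rewrite (gt_eqF c0) implybT.
rewrite powRr1 ?ltW// !powRN.
by field; rewrite !gt_eqF ?powR_gt0.
Qed.

(** This is where alpha-th powers of the path come from: integrating an exceedance of 1 over all
    dilations of a value x yields x^alpha. *)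
Lemma integral_pareto_tail (x : R) : (0 <= x)%R ->
  \int[mu]_u ((\1_[set u : R | (1 < u * x)%R] u)%:E * (pareto_density u)%:E) = (x `^ alpha)%:E.
Proof.
rewrite le_eqVlt => /predU1P[<-|x0].
  rewrite powR0 ?gt_eqF// integral0_eq// => u _.
  by rewrite indicE memNset ?mul0e//= mulr0 ltr10.
have m1 : measurable_fun setT (fun u => (\1_`]1%R, +oo[%classic (u : measurableTypeR R) : R)%:E).
  by apply/measurable_EFinP; exact: measurable_indic.
transitivity (\int[mu]_u ((\1_`]1%R, +oo[%classic (x * u)%R)%:E * (pareto_density u)%:E)).
  apply: eq_integral => u _; congr (_%:E * _); rewrite !indicE; congr (nat_of_bool _)%:R.
  by apply/idP/idP; rewrite !inE/= in_itv/= andbT mulrC.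
rewrite (integral_pareto_scale (f := fun u => (\1_`]1%R, +oo[%classic (u : measurableTypeR R) : R)%:E))//.
rewrite [X in _ * X](_ : _ = 1) ?mule1//.
rewrite -integral_power1y -integral_itv_obnd_cbnd; last first.
  apply/measurable_EFinP/measurable_funTS; apply: measurable_funM => //; exact: measurable_powR.
rewrite [RHS]integral_mkcond; apply: eq_integral => u _.
rewrite patchE indicE /pareto_density; have [|_] := boolP (u \in `]1%R, +oo[%classic); last by rewrite mul0e.
by rewrite inE/= in_itv/= andbT mul1e => /(lt_trans ltr01) ->.
Qed.

(** Substituting x v for v reduces to the unit interval. The density alpha v^(alpha-1) appears in
    [integral_ray_mass], once powers of u gained by homogeneity are absorbed into the Pareto
    density. *)
Lemma integral_power0x (x : R) : (0 < x)%R ->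
  \int[mu]_v ((\1_`]0%R, x[%classic (v : measurableTypeR R) : R)%:E * (alpha * v `^ (alpha - 1))%:E) = (x `^ alpha)%:E.
Proof.
move=> x0.
have mf y : measurable_fun setT (fun v => (\1_`]0%R, y[%classic (v : measurableTypeR R) : R)%:E * (alpha * v `^ (alpha - 1))%:E).
  apply: emeasurable_funM; apply/measurable_EFinP; first exact: measurable_indic.
  by apply: measurable_funM => //; exact: measurable_powR.
have f0 y v : 0 <= (\1_`]0%R, y[%classic (v : measurableTypeR R) : R)%:E * (alpha * v `^ (alpha - 1))%:E.
  by rewrite mule_ge0 ?lee_fin// mulr_ge0 ?powR_ge0// ltW.
rewrite (@integral_lebesgue_affine _ x 0 (fun v => (\1_`]0%R, x[%classic (v : measurableTypeR R) : R)%:E * (alpha * v `^ (alpha - 1))%:E)) ?gt_eqF//.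

rewrite gtr0_norm// -[RHS]mule1 -integral_power01 -integral_itv_bndo_bndc; last first.
  apply/measurable_EFinP/measurable_funTS; apply: measurable_funM => //; exact: measurable_powR.
rewrite [in RHS]integral_mkcond -!ge0_integralZl//; first last.
- by rewrite lee_fin powR_ge0.
- move=> v _; rewrite patchE; case: ifPn => // _.
  by rewrite lee_fin mulr_ge0 ?powR_ge0// ltW.
- apply/(measurable_restrictT _ _).1; first exact: measurable_itv.
  apply/measurable_EFinP/measurable_funTS; apply: measurable_funM => //; exact: measurable_powR.
- by rewrite lee_fin ltW.
- by apply: (measurableT_comp (mf x)); apply: measurable_funD => //; exact: measurable_funM.
apply: eq_integral => v _; rewrite addr0 patchE indicE.
have -> : ((x * v)%R \in `]0%R, x[%classic) = (v \in `]0%R, 1%R[%classic).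
  apply/idP/idP; rewrite !inE/= !in_itv/= pmulr_rgt0// => /andP[-> /=];
  by rewrite -ltr_pdivlMl// mulVf// gt_eqF.
have [|_] := boolP (v \in `]0%R, 1%R[%classic); last by rewrite mul0e !mule0.
rewrite inE/= in_itv/= mul1e => /andP[v0 _]; rewrite -!EFinM; congr EFin.
rewrite powRM ?ltW// [(x `^ (_ - 1))%R]powRB; last by rewrite (gt_eqF x0) implybT.
by rewrite powRr1 ?ltW//; field; rewrite gt_eqF.
exact: mf.
Qed.

End power_integrals.

(** * Path functionals *)

Section cadlag_algebra.
Context {R : realType} {d : nat}.
Implicit Types (y z : cadlag R d).

Lemma cadlag_eq y z : (forall t, y t = z t) -> y = z.
Proof.
case: y z => [f fP] [g gP] /= /funext fg; rewrite fg in fP *.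
by congr Cadlag; exact: Prop_irrelevance.
Qed.

Lemma cadlag_shift0 y : cadlag_shift 0 y = y.
Proof. by apply: cadlag_eq => t /=; rewrite subr0. Qed.

Lemma cadlag_shiftD s t y :
  cadlag_shift s (cadlag_shift t y) = cadlag_shift (s + t) y.
Proof. by apply: cadlag_eq => r /=; rewrite -addrA -opprD. Qed.

Lemma cadlag_scale1 y : cadlag_scale 1 y = y.
Proof. by apply: cadlag_eq => t /=; rewrite scale1r. Qed.

Lemma cadlag_scaleM u v y :
  cadlag_scale u (cadlag_scale v y) = cadlag_scale (u * v) y.
Proof. by apply: cadlag_eq => r /=; rewrite scalerA. Qed.

Lemma cadlag_scale_shift u t y :
  cadlag_scale u (cadlag_shift t y) = cadlag_shift t (cadlag_scale u y).
Proof. exact: cadlag_eq. Qed.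

Lemma cadlag_scale_image (t : R) (A : set (cadlag R d)) : t != 0 ->
  [set cadlag_scale t y | y in A] = cadlag_scale t^-1 @^-1` A.
Proof.
move=> t0; apply/seteqP; split => [_ [y Ay <-]|y Ay].
  by rewrite /= cadlag_scaleM mulVf// cadlag_scale1.
by exists (cadlag_scale t^-1 y) => //; rewrite cadlag_scaleM divff// cadlag_scale1.
Qed.

Lemma measurable_shift (t : R) : measurable_fun setT (cadlag_shift t : cadlag R d -> _).
Proof. exact: (measurableT_comp measurable_cadlag_shift (measurable_pair1 t)). Qed.

Lemma measurable_scale (u : R) : measurable_fun setT (cadlag_scale u : cadlag R d -> _).
Proof. exact: (measurableT_comp measurable_cadlag_scale (measurable_pair1 u)). Qed.

End cadlag_algebra.

Section orbit_integral.
Local Open Scope ereal_scope.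
Context {R : realType} {d : nat}.
Local Notation mu := (@lebesgue_measure R).
Variable h : cadlag R d -> \bar R.
Hypotheses (mh : measurable_fun setT h) (h0 : forall y, 0 <= h y).

Definition orbit_integral y := \int[mu]_t h (cadlag_shift t y).

Lemma orbit_integral_ge0 y : 0 <= orbit_integral y.
Proof. by apply: integral_ge0. Qed.

Lemma measurable_orbit : measurable_fun setT
  (fun p : measurableTypeR R * cadlag R d => h (cadlag_shift p.1 p.2)).
Proof. exact: measurableT_comp measurable_cadlag_shift. Qed.

Lemma measurable_orbit1 y :
  measurable_fun setT (fun t : measurableTypeR R => h (cadlag_shift t y)).
Proof. exact: measurableT_comp measurable_orbit (measurable_pair2 y). Qed.

Lemma measurable_orbit_integral : measurable_fun setT orbit_integral.
Proof.
by apply: (measurable_fun_fubini_tonelli_G (m1 := mu) _ measurable_orbit).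
Qed.

Lemma orbit_integral_shift s y :
  orbit_integral (cadlag_shift s y) = orbit_integral y.
Proof.
rewrite /orbit_integral [RHS](@integral_lebesgue_affine _ 1 s) ?oner_eq0//.
  by rewrite normr1 mul1e; apply: eq_integral => t _; rewrite cadlag_shiftD mul1r.
exact: measurable_orbit1.
Qed.

Lemma orbit_integralN y :
  \int[mu]_t h (cadlag_shift (- t) y) = orbit_integral y.
Proof.
rewrite /orbit_integral [RHS](@integral_lebesgue_affine _ (-1) 0) ?oppr_eq0 ?oner_eq0//.
  by rewrite normrN1 mul1e; apply: eq_integral => t _; rewrite addr0 mulN1r.
exact: measurable_orbit1.
Qed.

End orbit_integral.

Section functionals.
Local Open Scope ereal_scope.
Context {R : realType} {d : nat} (N : 'rV[R]_d -> R) (N_norm : is_norm N).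
Implicit Types (y z : cadlag R d).
Local Notation mu := (@lebesgue_measure R).

Lemma cadlag_norm_scale u y t : N (cadlag_scale u y t) = (`|u| * N (y t))%R.
Proof. exact: is_normZ. Qed.

Lemma measurable_exceed0 : measurable (exceed0 N).
Proof.
rewrite (_ : exceed0 N = [set: cadlag R d] `&`
    (fun y : cadlag R d => N (y 0%R)) @^-1` `]1%R, +oo[%classic); last first.
  by apply/seteqP; split => y /=; rewrite in_itv/= andbT => // -[].
by apply: measurable_norm_eval => //; exact: measurable_itv.
Qed.

Definition exceed0_indic y : \bar R := (\1_(exceed0 N) y)%:E.

Lemma measurable_exceed0_indic : measurable_fun setT exceed0_indic.
Proof. by apply/measurable_EFinP; exact: measurable_indic measurable_exceed0. Qed.

Lemma exceed0_indic_ge0 y : 0 <= exceed0_indic y.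
Proof. by rewrite lee_fin. Qed.

Lemma exceed0_indicE y : exceed0_indic y = ((1 < N (y 0%R))%R%:R)%:E.
Proof.
rewrite /exceed0_indic indicE; congr (nat_of_bool _)%:R%:E.
by apply/idP/idP; rewrite inE.
Qed.

(** Since (B^(-t) y)_0 = y_t and reflecting time preserves Lebesgue measure, E is an orbit integral.
    This makes it measurable, shift-invariant and accessible to mass transport. *)
Lemma exceedE y : exceed N y = orbit_integral exceed0_indic y.
Proof.
rewrite -orbit_integralN; [|exact: measurable_exceed0_indic|exact: exceed0_indic_ge0].
apply: eq_integral => t _; rewrite exceed0_indicE /= opprK add0r indicE.
by congr (nat_of_bool _)%:R%:E; apply/idP/idP; rewrite inE.
Qed.

Lemma measurable_exceed : measurable_fun setT (exceed N).
Proof.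
rewrite (_ : exceed N = orbit_integral exceed0_indic).
  apply: measurable_orbit_integral; [exact: measurable_exceed0_indic|exact: exceed0_indic_ge0].
by apply/funext => y; rewrite exceedE.
Qed.

Lemma exceed_shift t y : exceed N (cadlag_shift t y) = exceed N y.
Proof.
rewrite !exceedE orbit_integral_shift//; [exact: measurable_exceed0_indic|exact: exceed0_indic_ge0].
Qed.

Lemma exceed_ge0 y : 0 <= exceed N y.
Proof. by rewrite exceedE; apply: orbit_integral_ge0 => z; exact: exceed0_indic_ge0. Qed.

Lemma measurable_exceedance_time y c :
  measurable ([set s | (c < N (y s))%R] : set (measurableTypeR R)).
Proof.
rewrite (_ : [set s | _] = [set: measurableTypeR R] `&`
    (fun s => N (y s)) @^-1` `]c, +oo[%classic); last first.
  by apply/seteqP; split => s /=; rewrite in_itv/= andbT => // -[].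
by apply: measurable_normT => //; exact: measurable_itv.
Qed.

(** By right continuity an exceedance lasts for a positive time. *)
Lemma exceed_gt0 y t : (1 < N (y t))%R -> 0 < exceed N y.
Proof.
move=> yt; have [e e0 eP] := near_right_exceed N_norm yt.
rewrite /exceed integral_indic//; last exact: measurable_exceedance_time.
rewrite setIT; apply: (@lt_le_trans _ _ (mu `[t, (t + e)%R[%classic)).
  by rewrite lebesgue_measure_itv/= lte_fin ltrDl e0 -EFinD lte_fin addrAC subrr add0r.
apply: le_measure; rewrite ?inE.
- exact: measurable_itv.
- exact: measurable_exceedance_time.
- by move=> s /=; rewrite in_itv/=; exact: eP.
Qed.

Lemma sup_norm_ub y t : (N (y t))%:E <= sup_norm N y.
Proof. by apply: ereal_sup_ubound; exists t. Qed.

Lemma sup_norm_ge0 y : 0 <= sup_norm N y.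
Proof.
by apply: le_trans (sup_norm_ub y 0%R); rewrite lee_fin (is_norm_ge0 N_norm).
Qed.

Lemma sup_norm_shift t y : sup_norm N (cadlag_shift t y) = sup_norm N y.
Proof.
congr ereal_sup; apply/seteqP; split => _ [s _ <-]; first by exists (s - t)%R.
by exists (s + t)%R => //=; rewrite addrK.
Qed.

Lemma sup_norm_scale u y : (0 < u)%R ->
  sup_norm N (cadlag_scale u y) = u%:E * sup_norm N y.
Proof.
move=> u0; apply/eqP; rewrite eq_le; apply/andP; split.
  apply: ge_ereal_sup => _ [t _ <-]; rewrite cadlag_norm_scale gtr0_norm// EFinM.
  by rewrite lee_pmul2l ?lte_fin// sup_norm_ub.
rewrite -lee_pdivlMl//; apply: ge_ereal_sup => _ [t _ <-].
rewrite lee_pdivlMl//; apply: le_trans (sup_norm_ub _ t).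
by rewrite cadlag_norm_scale gtr0_norm// EFinM.
Qed.

Lemma sup_norm_gt y c : c%:E < sup_norm N y <-> exists t, (c < N (y t))%R.
Proof.
split=> [/ereal_sup_gt[_ [t _ <-]]|[t]]; first by rewrite lte_fin; exists t.
by rewrite -lte_fin => /lt_le_trans; apply; exact: sup_norm_ub.
Qed.

Lemma sup_norm_eq0 y : sup_norm N y = 0 <-> y = cadlag0.
Proof.
split=> [y0|->]; last first.
  apply/eqP; rewrite eq_le sup_norm_ge0 andbT; apply: ge_ereal_sup => _ [t _ <-].
  by rewrite (is_norm0 N_norm).
apply: cadlag_eq => t; apply: (is_norm_eq0 N_norm); apply/eqP.
by rewrite eq_le (is_norm_ge0 N_norm) andbT; have := sup_norm_ub y t; rewrite y0 lee_fin.
Qed.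

Lemma measurable_sup_norm : measurable_fun setT (sup_norm N : cadlag R d -> _).
Proof.
apply: (measurability _ (ErealGenOInfty.measurableE R)) => //.
move=> /= _ [_ [c ->] <-]; rewrite setTI preimage_itvoy.
rewrite [X in measurable X](_ : _ =
    [set y : cadlag R d | exists2 s, [set: R] s & (c < N (y s))%R]).
  by apply: measurable_exceedance => //; exact: openT.
apply/seteqP; split => y /=; first by move=> /sup_norm_gt[t]; exists t.
by move=> [t _ ct]; apply/sup_norm_gt; exists t.
Qed.

Lemma measurable_cadlag0 : measurable [set (cadlag0 : cadlag R d)].
Proof.
rewrite (_ : [set _] = [set: cadlag R d] `&` (sup_norm N @^-1` [set 0])).
  by apply: measurable_sup_norm => //; exact: emeasurable_set1.
by apply/seteqP; split => y /=; [move=> ->; split => //; apply/sup_norm_eq0|move=> [_ /sup_norm_eq0]; exact].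
Qed.

Lemma exceed_gt0P y : 0 < exceed N y <-> 1 < sup_norm N y.
Proof.
split=> [|/sup_norm_gt[t]]; last exact: exceed_gt0.
apply: contraPP => /negP; rewrite -leNgt => y1; apply/negP; rewrite -leNgt.
rewrite /exceed integral0_eq// => s _; rewrite indicE memNset//=.
by apply/negP; rewrite -leNgt -lee_fin; apply: le_trans y1; exact: sup_norm_ub.
Qed.


(** Countably many levels and windows suffice, which exhibits D_0 as a countable combination of
    exceedance sets over the open time sets |s| > m. *)
Lemma D0P y : D0 N y <->
  forall n, exists m, forall s, (m%:R < `|s|)%R -> (N (y s) <= n.+1%:R^-1)%R.
Proof.
split=> [[yp ym] n|yP].
  move/cvgrPdist_le : yp => /(_ n.+1%:R^-1%R); rewrite invr_gt0 ltr0n => /(_ isT).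
  move=> [a [_ aP]].
  move/cvgrPdist_le : ym => /(_ n.+1%:R^-1%R); rewrite invr_gt0 ltr0n => /(_ isT).
  move=> [b [_ bP]].
  exists (maxn (Num.bound a) (Num.bound b)) => s.
  have ab : (a <= (maxn (Num.bound a) (Num.bound b))%:R)%R.
    rewrite (le_trans (ler_norm a))// (le_trans (ltW (archi_boundP (normr_ge0 a))))//.
    by rewrite /Num.bound normr_id ler_nat leq_max leqnn.
  have bb : (- b <= (maxn (Num.bound a) (Num.bound b))%:R)%R.
    rewrite (le_trans (ler_norm _))// normrN (le_trans (ltW (archi_boundP (normr_ge0 b))))//.
    by rewrite /Num.bound normr_id ler_nat leq_max leqnn orbT.
  have N0 := is_norm_ge0 N_norm (y s).
  rewrite ltr_normr => /orP[ms|ms].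
    by have := aP _ (le_lt_trans ab ms); rewrite sub0r normrN ger0_norm.
  have sb : (s < b)%R by move: (le_lt_trans bb ms); lra.
  by have := bP _ sb; rewrite sub0r normrN ger0_norm.
split; apply/cvgrPdist_le => e e0.
- have /filter_ex[n ne] := near_infty_natSinv_lt (PosNum e0).
  have [m mP] := yP n; exists m%:R; split => [|s ms]; first by rewrite num_real.
  rewrite sub0r normrN ger0_norm ?(is_norm_ge0 N_norm)//.
  apply: le_trans (ltW ne); apply: mP; apply: lt_le_trans ms (ler_norm _).
- have /filter_ex[n ne] := near_infty_natSinv_lt (PosNum e0).
  have [m mP] := yP n; exists (- m%:R)%R; split => [|s ms]; first by rewrite num_real.
  rewrite sub0r normrN ger0_norm ?(is_norm_ge0 N_norm)//.
  apply: le_trans (ltW ne); apply: mP; rewrite -normrN.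
  by apply: lt_le_trans (ler_norm _); rewrite ltrNr.
Qed.

Lemma measurable_D0 : measurable (D0 N : set (cadlag R d)).
Proof.
rewrite (_ : D0 N = \bigcap_n \bigcup_m ~`
   [set y : cadlag R d | exists2 s, [set s | (m%:R < `|s|)%R] s & (n.+1%:R^-1 < N (y s))%R]).
  apply: bigcapT_measurable => n; apply: bigcupT_measurable => m.
  apply: measurableC; apply: (measurable_exceedance N_norm).
  have : open ((fun s : R => `|s|%R) @^-1` [set x | (m%:R < x)%R]).
    by apply: open_comp => [x _|]; [exact: norm_continuous|exact: open_gt].
  by [].
apply/seteqP; split => [y /D0P yP n _|y yP].
  by have [m mP] := yP n; exists m => // -[s /= /mP]; rewrite leNgt => /negP.
apply/D0P => n; have [m _ mP] := yP n Logic.I; exists m => s ms.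
by rewrite leNgt; apply/negP => ns; apply: mP; exists s.
Qed.

Lemma exceed_le_itv y (m : R) : (forall s, m < `|s| -> N (y s) <= 1)%R ->
  exceed N y < +oo.
Proof.
move=> mP; rewrite /exceed integral_indic//; last exact: measurable_exceedance_time.
rewrite setIT; apply: (@le_lt_trans _ _ (mu `[(- m)%R, m])); last first.
  by rewrite lebesgue_measure_itv; case: ifPn => _; rewrite ?ltry// -EFinB ltry.
apply: le_measure; rewrite ?inE.
- exact: measurable_exceedance_time.
- exact: measurable_itv.
- move=> s /= s1; rewrite in_itv/= -ler_norml leNgt; apply/negP => /mP.
  by rewrite leNgt s1.
Qed.

Lemma D0_exceed y : D0 N y -> exceed N y < +oo.
Proof.
move=> /D0P/(_ 0%N)[m mP]; apply: (@exceed_le_itv y m%:R) => s /mP.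
by rewrite invr1.
Qed.

Lemma D0_sup_norm y : D0 N y -> sup_norm N y < +oo.
Proof.
move=> /D0P/(_ 0%N)[m mP].
have [M M0 bM] := cadlag_bounded y m%:R.
have [C C0 NC] := is_norm_ball N_norm.
apply: (@le_lt_trans _ _ (1 + C * M)%:E); last exact: ltry.
apply: ge_ereal_sup => _ [t _ <-]; rewrite lee_fin.
have [tm|mt] := leP `|t|%R (m%:R)%R.
  have := NC _ _ _ (bM t _); rewrite -ler_norml => /(_ tm).
  by rewrite (is_norm0 N_norm) sub0r normrN ger0_norm ?(is_norm_ge0 N_norm)//; lra.
have := mP _ mt; rewrite invr1 => /le_trans; apply.
by rewrite lerDl mulr_ge0// ltW.
Qed.


Definition path_power (alpha : R) y : \bar R := (N (y 0%R) `^ alpha)%:E.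

Lemma measurable_path_power alpha : measurable_fun setT (path_power alpha).
Proof.
apply/measurable_EFinP; apply: (measurableT_comp (measurable_powR _)).
exact: measurable_norm_eval.
Qed.

Lemma path_power_ge0 alpha y : 0 <= path_power alpha y.
Proof. by rewrite lee_fin powR_ge0. Qed.

Lemma orbit_path_power alpha y : orbit_integral (path_power alpha) y =
  \int[mu]_t (N (y t) `^ alpha)%:E.
Proof.
rewrite -orbit_integralN; [|exact: measurable_path_power|exact: path_power_ge0].
by apply: eq_integral => t _; rewrite /path_power/= opprK add0r.
Qed.

Lemma DalphaE alpha y :
  Dalpha N alpha y = (orbit_integral (path_power alpha) y < +oo) :> Prop.
Proof. by rewrite orbit_path_power. Qed.

Lemma measurable_Dalpha alpha : measurable (Dalpha N alpha : set (cadlag R d)).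
Proof.
rewrite (_ : Dalpha N alpha = [set: cadlag R d] `&`
   [set y | orbit_integral (path_power alpha) y < +oo]); last first.
  by rewrite setTI; apply/seteqP; split => y; rewrite /= DalphaE.
apply: emeasurable_fun_infty_o => //.
by apply: measurable_orbit_integral; [exact: measurable_path_power|exact: path_power_ge0].
Qed.

Lemma Dalpha_shift alpha t y : Dalpha N alpha y -> Dalpha N alpha (cadlag_shift t y).
Proof.
rewrite !DalphaE orbit_integral_shift//; [exact: measurable_path_power|exact: path_power_ge0].
Qed.

Lemma Dalpha_scale alpha u y : Dalpha N alpha y -> Dalpha N alpha (cadlag_scale u y).
Proof.
rewrite /Dalpha/= => yfin.
under eq_integral do rewrite cadlag_norm_scale powRM ?(is_norm_ge0 N_norm)// EFinM.
rewrite ge0_integralZl ?lee_fin ?powR_ge0//; last 2 first.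
- apply/measurable_EFinP; apply: (measurableT_comp (measurable_powR _)).
  exact: measurable_normT.
- by move=> t _; rewrite lee_fin powR_ge0.
by rewrite lte_mul_pinfty ?lee_fin ?powR_ge0.
Qed.

(** Markov's inequality: an indicator of |y_t| > 1 is at most |y_t|^alpha. *)
Lemma Dalpha_exceed alpha y : (0 < alpha)%R -> Dalpha N alpha y -> exceed N y < +oo.
Proof.
move=> a0; apply: le_lt_trans; apply: ge0_le_integral => //.
- by apply/measurable_EFinP; apply: measurable_indic; exact: measurable_exceedance_time.
- apply/measurable_EFinP; apply: (measurableT_comp (measurable_powR _)).
  exact: measurable_normT.
- move=> t _; rewrite lee_fin indicE; have [|_] := boolP (t \in _); last exact: powR_ge0.
  rewrite inE/= => t1; have := @ge0_ler_powR R alpha (ltW a0) 1%R (N (y t)).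
  rewrite powR1 !nnegrE; apply; rewrite ?ler01 ?ltW//.
  exact: lt_trans t1.
Qed.

Lemma normalize_shift t y :
  normalize N (cadlag_shift t y) = cadlag_shift t (normalize N y).
Proof. by rewrite /normalize sup_norm_shift cadlag_scale_shift. Qed.

Lemma normalize_scale u y : (0 < u)%R ->
  normalize N (cadlag_scale u y) = normalize N y.
Proof.
move=> u0; rewrite /normalize sup_norm_scale// cadlag_scaleM.
have := sup_norm_ge0 y; case: (sup_norm N y) => [r|_|//] /=.
  by rewrite invfM mulrAC mulVf ?gt_eqF// mul1r.
(* For an infinite supremum [fine] returns 0, whose inverse is 0, so both sides are the null
   path. *)
by rewrite gt0_muley ?lte_fin//= !invr0 mul0r.
Qed.

Lemma sup_norm_normalize y : 0 < sup_norm N y -> sup_norm N y < +oo ->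
  sup_norm N (normalize N y) = 1.
Proof.
rewrite /normalize => y0 yfin; have yE : sup_norm N y = (fine (sup_norm N y))%:E.
  by rewrite fineK// ge0_fin_numE// sup_norm_ge0.
have f0 : (0 < fine (sup_norm N y))%R by rewrite -lte_fin -yE.
rewrite sup_norm_scale ?invr_gt0// [X in _ * X]yE -EFinM mulVf// gt_eqF//.
Qed.

Lemma measurable_normalize : measurable_fun setT (normalize N : cadlag R d -> _).
Proof.
rewrite (_ : normalize N = (fun p : measurableTypeR R * cadlag R d => cadlag_scale p.1 p.2) \o
  (fun y => ((fine (sup_norm N y))^-1%R, y)))//.
apply: (measurableT_comp measurable_cadlag_scale).
apply/measurable_fun_pairP; split => /=; last exact: measurable_id.
(* On nonnegative reals the power -1 agrees with the inverse, including at 0, where both are 0. *)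
rewrite [X in measurable_fun _ X](_ : _ =
  (fun r : measurableTypeR R => r `^ (-1))%R \o (fine \o sup_norm N)).
  apply: measurableT_comp; first exact: measurable_powR.
  by apply: measurableT_comp => //; exact: measurable_sup_norm.
by apply/funext => y /=; rewrite powR_inv1// fine_ge0// sup_norm_ge0.
Qed.

End functionals.

Lemma measurable_inve d (T : measurableType d) (R : realType) (f : T -> \bar R) :
  measurable_fun setT f -> (forall x, 0 <= f x)%E ->
  measurable_fun setT (fun x => (f x)^-1)%E.
Proof.
move=> mf f0.
rewrite [X in measurable_fun _ X](_ : _ = (fun x => if f x == 0 then +oo else
   if f x == +oo then 0 else ((fine (f x)) `^ (-1))%:E)%E).
  apply: measurable_fun_ifT => //; first exact: measurable_fun_eqe.
  apply: measurable_fun_ifT => //; first exact: measurable_fun_eqe.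
  apply/measurable_EFinP; apply: (measurableT_comp (measurable_powR _)).
  exact: measurableT_comp.
apply/funext => x; have := f0 x; case: (f x) => [r r0|_|//] /=.
  have [[->]|rn0] := eqVneq r%:E 0%E; first by rewrite inve0.
  by rewrite powR_inv1 -?lee_fin// inver; move: rn0; rewrite eqe => /negbTE ->.
by rewrite invey.
Qed.

(** * Null sets and auxiliary measures *)

Local Open Scope ereal_scope.

Section null_sets.
Context d (T : measurableType d) (R : realType) (mu : {measure set T -> \bar R}).

Lemma integral_indicT (A : set T) : measurable A ->
  \int[mu]_x (\1_A x : R)%:E = mu A.
Proof. by move=> mA; rewrite integral_indic// setIT. Qed.

Lemma measure0_subset (A B : set T) : measurable A -> measurable B ->
  A `<=` B -> mu B = 0 -> mu A = 0.
Proof.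
by move=> mA mB AB B0; apply/eqP; rewrite -measure_le0 -B0 le_measure// inE.
Qed.

Lemma measure0_bigcup (F : (set T)^nat) : (forall n, measurable (F n)) ->
  (forall n, mu (F n) = 0) -> mu (\bigcup_n F n) = 0.
Proof.
move=> mF F0; apply/negligibleP; first exact: bigcupT_measurable.
by apply: negligible_bigcup => n; apply/negligibleP => //; exact: F0.
Qed.

Lemma measure0_setU (A B : set T) : measurable A -> measurable B ->
  mu A = 0 -> mu B = 0 -> mu (A `|` B) = 0.
Proof.
move=> mA mB A0 B0; apply/negligibleP; first exact: measurableU.
by apply: negligibleU; apply/negligibleP.
Qed.

Lemma ge0_integral_eq0_null (f : T -> \bar R) : measurable_fun setT f ->
  (forall x, 0 <= f x) -> \int[mu]_x f x = 0 -> mu [set x | 0 < f x] = 0.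
Proof.
move=> mf f0 If0.
have : \int[mu]_x `|f x| = 0 by rewrite -If0; apply: eq_integral => x _; rewrite gee0_abs.
move=> /(ae_eq_integral_abs mu measurableT mf) [B [mB B0 fB]].
apply: (measure0_subset _ mB _ B0).
  by rewrite -[X in measurable X]setTI; exact: emeasurable_fun_o_infty.
by move=> x /= fx; apply: fB => /= /(_ I)/= fx0; rewrite fx0 ltxx in fx.
Qed.

Lemma ge0_integral_lty_null (f : T -> \bar R) : measurable_fun setT f ->
  (forall x, 0 <= f x) -> \int[mu]_x f x < +oo -> mu [set x | f x = +oo] = 0.
Proof.
move=> mf f0 If.
have fi : mu.-integrable setT f.
  by apply/integrableP; split => //; under eq_integral do rewrite gee0_abs//.
have [B [mB B0 fB]] := integrable_ae measurableT fi.
apply: (measure0_subset _ mB _ B0).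
  rewrite (_ : [set x | _] = [set: T] `&` f @^-1` [set +oo]) ?setTI//.
  rewrite -[X in measurable X]setTI; apply: mf => //; exact: emeasurable_set1.
by move=> x /= fx; apply: fB => /= /(_ I); rewrite fx.
Qed.

Lemma ge0_eq_integral_off_null (B : set T) (f g : T -> \bar R) :
  measurable B -> mu B = 0 ->
  measurable_fun setT f -> measurable_fun setT g ->
  (forall x, 0 <= f x) -> (forall x, 0 <= g x) ->
  (forall x, ~ B x -> f x = g x) -> \int[mu]_x f x = \int[mu]_x g x.
Proof.
move=> mB B0 mf mg f0 g0 fg; apply: ge0_ae_eq_integral => //.
exists B; split => // x /= /not_implyP[_ fgx]; apply: contrapT => Bx.
by apply: fgx; exact: fg.
Qed.

End null_sets.

Section weighted_measure.
Context d (T : measurableType d) (R : realType) (mu : {measure set T -> \bar R}).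
Variables (w : T -> R) (mw : measurable_fun setT w) (w0 : forall x, (0 <= w x)%R).

(** The two proofs are arguments so that the term itself carries the hypotheses that make it a
    measure. *)
Let wm of measurable_fun setT w & (forall x, (0 <= w x)%R) :=
  fun A : set T => \int[mu]_(x in A) (w x)%:E.
Let m := wm mw w0.

Let m0 : m set0 = 0. Proof. by rewrite /m /wm integral_set0. Qed.
Let m_ge0 A : 0 <= m A.
Proof. by apply: integral_ge0 => x _; rewrite lee_fin. Qed.
Let m_sigma_additive : semi_sigma_additive m.
Proof.
move=> F mF tF mUF; rewrite /m /wm ge0_integral_bigcup//.
- by apply: is_cvg_ereal_nneg_natsum_cond => n _ _; exact: m_ge0.
- by apply/measurable_EFinP; exact: measurable_funTS.
- by move=> x _; rewrite lee_fin.
Qed.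
HB.instance Definition _ := isMeasure.Build _ _ _ m m0 m_ge0 m_sigma_additive.

Lemma weighted_probability : \int[mu]_x (w x)%:E = 1 ->
  exists P : probability T R, forall A, measurable A ->
    P A = \int[mu]_x ((\1_A x)%:E * (w x)%:E).
Proof.
move=> w1.
pose isP := @Measure_isProbability.Build _ _ _ m w1.
pose P : probability T R := HB.pack m isP.
exists P => A mA; rewrite -[LHS]/(\int[mu]_(x in A) (w x)%:E) integral_mkcond.
apply: eq_integral => x _; rewrite patchE indicE.
by case: ifPn => _; rewrite ?mul1e ?mul0e.
Qed.

End weighted_measure.

Section sigma_finite_pack.
Context d (T : measurableType d) (R : realType) (mu : {measure set T -> \bar R}).
Hypothesis sf : sigma_finite setT mu.

Let sfm of sigma_finite setT mu := fun A : set T => mu A.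
Let m := sfm sf.
Let m0 : m set0 = 0. Proof. exact: measure0. Qed.
Let m_ge0 A : 0 <= m A. Proof. exact: measure_ge0. Qed.
Let m_sigma_additive : semi_sigma_additive m.
Proof. exact: measure_semi_sigma_additive. Qed.
HB.instance Definition _ := isMeasure.Build _ _ _ m m0 m_ge0 m_sigma_additive.
HB.instance Definition _ := @Measure_isSigmaFinite.Build _ _ _ m sf.

(** Tonelli's theorem is about bundled sigma-finite measures, whereas sigma-finiteness of nu is only
    proved later; this turns the property into the structure. *)
Lemma sigma_finite_measure_pack :
  exists nu : {sigma_finite_measure set T -> \bar R},
    (nu : {measure set T -> \bar R}) = mu.
Proof. by exists m; exact: eq_measure. Qed.

End sigma_finite_pack.

Lemma sigma_finite_tonelli d1 d2 (X : measurableType d1) (Z : measurableType d2)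
    (R : realType) (nu : {measure set X -> \bar R})
    (m : {sigma_finite_measure set Z -> \bar R}) (f : X * Z -> \bar R) :
  sigma_finite setT nu -> measurable_fun setT f -> (forall p, 0 <= f p) ->
  \int[nu]_x \int[m]_z f (x, z) = \int[m]_z \int[nu]_x f (x, z).
Proof.
by move=> /sigma_finite_measure_pack[snu <-] mf f0; exact: fubini_tonelli.
Qed.

Lemma measurable_set_ltr d (T : measurableType d) (R : realType) (f g : T -> R) :
  measurable_fun setT f -> measurable_fun setT g -> measurable [set x | (f x < g x)%R].
Proof.
move=> mf mg; have := measurable_fun_ltr mf mg measurableT (Y := [set true]).
by rewrite setTI; apply.
Qed.

(** The representation is a triple integral, over time, scale and randomness. To apply Tonelli to a
    product whose second factor is itself a product, that factor must be sigma-finite. *)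
Lemma sigma_finite_product_probability d1 d2 (X : measurableType d1)
    (Z : measurableType d2) (R : realType)
    (m : {sigma_finite_measure set X -> \bar R}) (P : probability Z R) :
  exists m2 : {sigma_finite_measure set (X * Z)%type -> \bar R},
    forall A, m2 A = (m \x P) A.
Proof.
have [F TF Foo] := sigma_finiteT m.
have sf : sigma_finite setT (m \x P).
  exists (fun n => F n `*` setT).
    by rewrite -setX_bigcupl -TF setXTT.
  move=> n; have [mF Fn] := Foo n; split; first exact: measurableX.
  rewrite product_measure1E//.
  rewrite [X in _ * X](_ : _ = 1) ?mule1//; exact: probability_setT.
have [m2 m2E] := sigma_finite_measure_pack sf.
exists m2 => A.
exact: (congr1 (fun m' : {measure set (X * Z)%type -> \bar R} => m' A) m2E).
Qed.

Lemma probability_setC_eq1 d (T : measurableType d) (R : realType)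
    (P : probability T R) (A : set T) : measurable A ->
  P (~` A) = 1 <-> P A = 0.
Proof.
move=> mA; have := fin_num_measure P _ mA; rewrite probability_setC//.
case: (P A) => // r _; rewrite -EFinB; split => [[r1]|[->]]; last by rewrite subr0.
by congr EFin; lra.
Qed.

(** * Mass transport for shift-invariant tail measures *)

Section sigma_finite_tail.
Context (R : realType) (d : nat) (N : 'rV[R]_d -> R) (N_norm : is_norm N).
Variable nu : {measure set (cadlag R d) -> \bar R}.

Lemma separated_exceedance (a b c : R) (O : set R) : (a <= b)%R -> (0 < c)%R ->
  O `<=` `[a, b]%classic ->
  separated0 N [set y : cadlag R d | exists2 s, O s & (c < N (y s))%R].
Proof.
move=> ab c0 Oab; exists a, b; split => //.
apply: (@lt_le_trans _ _ c%:E); first by rewrite lte_fin.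
apply: le_ereal_inf_tmp => _ [y [s Os cs] <-].
apply: (@le_trans _ _ (N (y s))%:E); first by rewrite lee_fin ltW.
by apply: ereal_sup_ubound; exists s => //; exact: Oab.
Qed.

(** Apart from the null path, which has measure 0, every path exceeds some level 1/n during some
    window ]-n, n[, and such sets are separated from the null path. *)
Lemma boundedly_finite_sigma_finite : boundedly_finite N nu -> sigma_finite setT nu.
Proof.
move=> [nu0 nuB].
pose F n := if n is n'.+1 then
    [set y : cadlag R d | exists2 s, `]- n%:R, n%:R[%classic%R s & (n%:R^-1 < N (y s))%R]
  else [set cadlag0].
have mF n : measurable (F n).
  case: n => [|n]; last first.
    by apply: (measurable_exceedance N_norm); exact: interval_open.
  exact: (measurable_cadlag0 N_norm).
exists F; last first.
  move=> n; split; first exact: mF.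
  case: n (mF n) => [|n] mFn; first by rewrite nu0.
  apply: nuB => //; apply: (@separated_exceedance (- n.+1%:R) n.+1%:R) => //.
  - by rewrite lerNl (@le_trans _ _ 0%R)// oppr_le0.
  - exact: subset_itv_oo_cc.
apply/seteqP; split => // y _.
have [->|/eqP y0] := pselect (y = cadlag0); first by exists 0%N.
have : 0 < sup_norm N y.
  rewrite lt_def sup_norm_ge0// andbT; apply: contra y0 => /eqP/sup_norm_eq0 -> //.
move=> /sup_norm_gt[s s0].
have /filter_ex[n ns] := near_infty_natSinv_lt (PosNum s0).
(* One index has to serve both as the level, through n, and as the window, through the bound on
   s. *)
pose m := (n + Num.bound s)%N.
exists m.+1 => //=; exists s.
  rewrite in_itv/= -ltr_norml (lt_le_trans (archi_boundP (normr_ge0 s)))//.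
  rewrite (_ : Num.bound `|s|%R = Num.bound s); last by rewrite /Num.bound normr_id.
  by rewrite ler_nat ltnW// ltnS leq_addl.
apply: le_lt_trans ns; rewrite lef_pV2 ?posrE ?ltr0n// ler_nat ltnS leq_addr//.
Qed.

End sigma_finite_tail.

Section tail_measures.
Context (R : realType) (d : nat) (N : 'rV[R]_d -> R) (N_norm : is_norm N).
Context (alpha : R) (alpha_gt0 : (0 < alpha)%R).
Variable nu : {measure set (cadlag R d) -> \bar R}.
Hypotheses (nu_tail : tail_measure N alpha nu) (nu_shift : shift_invariant nu).
Local Notation mu := (@lebesgue_measure R).
Implicit Types (y z : cadlag R d) (h k : cadlag R d -> \bar R).

Lemma tail_sigma_finite : sigma_finite setT nu.
Proof. by apply: (boundedly_finite_sigma_finite N_norm); case: nu_tail. Qed.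

Lemma integral_shift (t : R) h : measurable_fun setT h -> (forall y, 0 <= h y) ->
  \int[nu]_y h (cadlag_shift t y) = \int[nu]_y h y.
Proof.
move=> mh h0.
rewrite [RHS](integral_image_density (measurable_shift t) (w := cst 1%R) _ _ (mu := nu))//=.
  by apply: eq_integral => y _; rewrite mule1.
move=> A mA; under eq_integral do rewrite mule1.
rewrite -(nu_shift t mA) -[X in nu X]setIT -integral_indic//.
by rewrite -[X in measurable X]setTI; exact: measurable_shift.
Qed.

Lemma tail_scale (u : R) (A : set (cadlag R d)) : (0 < u)%R -> measurable A ->
  nu (cadlag_scale u @^-1` A) = (u `^ alpha)%:E * nu A.
Proof.
move=> u0 mA; have [_ _ _ /(_ u^-1%R A)] := nu_tail.
rewrite invr_gt0 cadlag_scale_image ?invr_eq0 ?gt_eqF// invrK => -> //.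
by rewrite -powR_inv1 ?ltW// -powRrM mulrNN mul1r.
Qed.

Lemma integral_scale (u : R) h : (0 < u)%R ->
  measurable_fun setT h -> (forall y, 0 <= h y) ->
  \int[nu]_y h (cadlag_scale u y) = (u `^ alpha)%:E * \int[nu]_y h y.
Proof.
move=> u0 mh h0.
(* Homogeneity says that nu is the image of u^(-alpha) nu under multiplication by u. *)
rewrite (integral_image_density (measurable_scale u) (w := cst (u `^ (- alpha))%R) _ _ (mu := nu) _ mh)//=.
- rewrite ge0_integralZr ?lee_fin ?powR_ge0//; last exact: measurableT_comp (measurable_scale u).
  rewrite muleCA -EFinM -powRD ?(gt_eqF u0) ?implybT// subrr powRr0 mule1//.
- by move=> _; exact: powR_ge0.
- move=> A mA; rewrite ge0_integralZr ?lee_fin ?powR_ge0//; last first.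
    apply/measurable_EFinP; exact: measurableT_comp (measurable_indic _) (measurable_scale u).
  rewrite integral_indic; last by rewrite -[X in measurable X]setTI; exact: measurable_scale.
  rewrite setIT tail_scale// muleC muleA -EFinM -powRD ?(gt_eqF u0) ?implybT//.
  by rewrite addNr powRr0 mul1e.
exact: measurableT.
Qed.

(* The product h(y) k(B^s y) is integrated in the other order after the
   substitution y -> B^(-s) y, under which nu is invariant. *)
Lemma mass_transport h k :
  measurable_fun setT h -> (forall y, 0 <= h y) ->
  measurable_fun setT k -> (forall y, 0 <= k y) ->
  \int[nu]_y (h y * orbit_integral k y) = \int[nu]_y (k y * orbit_integral h y).
Proof.
move=> mh h0 mk k0.
transitivity (\int[nu]_y \int[mu]_t (h y * k (cadlag_shift t y))).
  by apply: eq_integral => y _; rewrite ge0_integralZl//; exact: measurable_orbit1.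
pose f (p : cadlag R d * measurableTypeR R) := h p.1 * k (cadlag_shift p.2 p.1).
have mshift : measurable_fun setT
    (fun p : cadlag R d * measurableTypeR R => cadlag_shift p.2 p.1).
  apply: (measurableT_comp measurable_cadlag_shift (g := fun p => (p.2, p.1))).
  by apply/measurable_fun_pairP; split => /=; [exact: measurable_snd|exact: measurable_fst].
have mf : measurable_fun setT f.
  apply: emeasurable_funM; first exact: measurableT_comp mh measurable_fst.
  exact: measurableT_comp mk mshift.
rewrite (@sigma_finite_tonelli _ _ _ _ _ nu mu f tail_sigma_finite)//; last by move=> p; rewrite mule_ge0.
pose g (p : cadlag R d * measurableTypeR R) := k p.1 * h (cadlag_shift (- p.2) p.1).
have mshiftN : measurable_fun setT
    (fun p : cadlag R d * measurableTypeR R => cadlag_shift (- p.2) p.1).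
  apply: (measurableT_comp mshift (g := fun p : cadlag R d * measurableTypeR R => (p.1, (- (p.2 : R))%R : measurableTypeR R))).
  apply/measurable_fun_pairP; split => /=; first exact: measurable_fst.
  by apply: measurable_funN; exact: measurable_snd.
have mg : measurable_fun setT g.
  apply: emeasurable_funM; first exact: measurableT_comp mk measurable_fst.
  exact: measurableT_comp mh mshiftN.
transitivity (\int[mu]_t \int[nu]_y g (y, t)).
  apply: eq_integral => t _; rewrite -[RHS](integral_shift t)//.
  - by apply: eq_integral => y _; rewrite /f/g/= cadlag_shiftD addNr cadlag_shift0 muleC.
  - exact: measurableT_comp mg (measurable_pair2 t).
  - by move=> y; rewrite mule_ge0.
rewrite -(@sigma_finite_tonelli _ _ _ _ _ nu mu g tail_sigma_finite)//; last by move=> p; rewrite mule_ge0.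
apply: eq_integral => y _; rewrite /g/= ge0_integralZl//.
- by rewrite orbit_integralN.
- apply: measurableT_comp (measurable_orbit1 mh y) _.
  exact: oppr_measurable.
Qed.


Lemma tail_null0 : nu [set cadlag0] = 0.
Proof. by case: nu_tail. Qed.

(** For shift-invariant A, exceeding 1 at some time is as negligible as exceeding 1 at time 0. Mass
    transport with h = 1 and k the indicator of A and G together gives a null orbit integral of k;
    on A this orbit integral is E, positive exactly when y^* > 1. *)
Lemma tail_null_exceeding (A : set (cadlag R d)) : measurable A ->
  (forall t y, A y -> A (cadlag_shift t y)) -> nu (A `&` exceed0 N) = 0 ->
  nu (A `&` [set y | 1 < sup_norm N y]) = 0.
Proof.
move=> mA As A0.
have mAG : measurable (A `&` exceed0 N) by apply: measurableI => //; exact: measurable_exceed0.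
pose k y : \bar R := (\1_(A `&` exceed0 N) y)%:E.
have mk : measurable_fun setT k by apply/measurable_EFinP; exact: measurable_indic.
have k0 y : 0 <= k y by rewrite lee_fin.
pose one (y : cadlag R d) : \bar R := 1%:E.
have one0 y : 0 <= one y by rewrite lee_fin.
have mone : measurable_fun setT one by exact: measurable_cst.
have : \int[nu]_y orbit_integral k y = 0.
  transitivity (\int[nu]_y (one y * orbit_integral k y)).
    by apply: eq_integral => y _; rewrite mul1e.
  rewrite mass_transport//.
  (* The orbit integral of the constant 1 is infinite, but k vanishes off a null set and 0 * +oo =
     0. *)
  transitivity (\int[nu]_y cst 0 y); last by rewrite integral_cst// mul0e.
  apply: (ge0_eq_integral_off_null mAG A0) => //.
  - by apply: emeasurable_funM => //; apply: measurable_orbit_integral.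
  - by move=> y; rewrite mule_ge0// orbit_integral_ge0.
  - by move=> y Ay; rewrite /k indicE memNset// mul0e.
move=> /ge0_integral_eq0_null -/(_ (measurable_orbit_integral mk k0) (orbit_integral_ge0 k0)).
apply: measure0_subset.
- apply: measurableI => //; rewrite -[X in measurable X]setTI.
  by apply: emeasurable_fun_o_infty => //; exact: measurable_sup_norm.
- rewrite -[X in measurable X]setTI.
  by apply: emeasurable_fun_o_infty => //; exact: measurable_orbit_integral.
- move=> y [Ay] /= /(exceed_gt0P N_norm); rewrite exceedE//.
  rewrite (_ : orbit_integral k y = orbit_integral (exceed0_indic N) y)//.
  by apply: eq_integral => t _; rewrite /k /exceed0_indic !indicE in_setI (mem_set (As t y Ay)) andTb.
Qed.

(** This is 1_G / E, real-valued in order to serve as a density. If E = +oo, [fine] and the real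
    inverse give 0, the value of the extended inverse; at E = 0 the two inverses differ, but there
    the indicator vanishes. *)
Definition reciprocal_exceed y : R := (\1_(exceed0 N) y * (fine (exceed N y))^-1)%R.

Lemma reciprocal_exceed_ge0 y : (0 <= reciprocal_exceed y)%R.
Proof. by rewrite mulr_ge0// invr_ge0 fine_ge0// exceed_ge0. Qed.

Lemma measurable_reciprocal_exceed : measurable_fun setT reciprocal_exceed.
Proof.
apply: measurable_funM; first exact: measurable_indic (measurable_exceed0 N_norm).
rewrite [X in measurable_fun _ X](_ : _ =
  (fun r : measurableTypeR R => r `^ (-1))%R \o (fine \o exceed N)).
  apply: measurableT_comp; first exact: measurable_powR.
  by apply: measurableT_comp => //; exact: measurable_exceed.
by apply/funext => y /=; rewrite powR_inv1// fine_ge0// exceed_ge0.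
Qed.

Lemma reciprocal_exceedE y :
  (reciprocal_exceed y)%:E = exceed0_indic N y * (exceed N y)^-1.
Proof.
rewrite /reciprocal_exceed /exceed0_indic indicE.
have [|_] := boolP (y \in _); last by rewrite mul0r mul0e.
rewrite inE => /(exceed_gt0 N_norm); rewrite mul1r mul1e.
case: (exceed N y) => [r|_|//]; last by rewrite /= invr0 invey.
by rewrite lte_fin => r0; rewrite /= inver gt_eqF.
Qed.

(** E is constant along the orbit and factors out, leaving E / E when E > 0 and 0 when E = 0. *)
Lemma orbit_reciprocal_exceed y : exceed N y < +oo ->
  orbit_integral (fun z => (reciprocal_exceed z)%:E) y = (\1_[set z | (1 < sup_norm N z)%E] y)%:E.
Proof.
move=> yfin; rewrite /orbit_integral.
under eq_integral do rewrite /reciprocal_exceed EFinM exceed_shift//.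
rewrite ge0_integralZr//; last 2 first.
- exact: (measurable_orbit1 (measurable_exceed0_indic N_norm)).
- by rewrite lee_fin invr_ge0 fine_ge0// exceed_ge0.
rewrite -[X in X * _]/(orbit_integral (exceed0_indic N) y) -exceedE// indicE.
have [|/negP] := boolP (y \in _); rewrite inE/=.
  move=> /(exceed_gt0P N_norm); move: yfin; case: (exceed N y) => // r _.
  by rewrite lte_fin => r0; rewrite -EFinM mulfV// gt_eqF.
move=> /(exceed_gt0P N_norm)/negP; rewrite -leNgt => y0.
by have /eqP -> : exceed N y == 0; [rewrite eq_le y0 exceed_ge0|rewrite mul0e].
Qed.


Definition unit_exceedance : set (cadlag R d) :=
  [set y | exists2 s, `]0%R, 1%R[%classic s & (1 < N (y s))%R].

Lemma measurable_unit_exceedance : measurable unit_exceedance.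
Proof. by apply: (measurable_exceedance N_norm); exact: interval_open. Qed.

Lemma unit_exceedance_lty : nu unit_exceedance < +oo.
Proof.
have [[_ nuB] _ _ _] := nu_tail; apply: nuB; first exact: measurable_unit_exceedance.
apply: (@separated_exceedance _ _ _ 0%R 1%R) => //; exact: subset_itv_oo_cc.
Qed.

Definition unit_exceedance_indic y : \bar R := (\1_unit_exceedance y)%:E.

Lemma measurable_unit_exceedance_indic : measurable_fun setT unit_exceedance_indic.
Proof. by apply/measurable_EFinP; exact: measurable_indic measurable_unit_exceedance. Qed.

Lemma unit_exceedance_indic_ge0 y : 0 <= unit_exceedance_indic y.
Proof. by rewrite lee_fin. Qed.

(** Each time s with |y_s| > 1 puts a whole unit interval ]-s, 1 - s[ into V. If such times were
    unbounded, V would keep mass at least 1 outside every [-n, n], contrary to its finite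
    measure. *)
Lemma orbit_unit_exceedance_bounded y :
  orbit_integral unit_exceedance_indic y < +oo ->
  exists m, forall s, (m%:R < `|s|)%R -> (N (y s) <= 1)%R.
Proof.
pose V := [set t : measurableTypeR R | unit_exceedance (cadlag_shift t y)].
have mV : measurable V.
  rewrite -[X in measurable X]setTI.
  have := measurable_orbit1 measurable_unit_exceedance_indic y.
  move=> /measurable_EFinP/(_ measurableT [set 1%R])-/(_ (measurable_set1 _)).
  congr measurable; apply/seteqP; split => t /= [_]; rewrite /unit_exceedance_indic indicE.
    by have [/set_mem //|_] := boolP (_ \in _) => /esym/eqP; rewrite oner_eq0.
  by move=> Vt; rewrite mem_set.
have -> : orbit_integral unit_exceedance_indic y = mu V.
  rewrite -integral_indicT//; exact: eq_integral.
move=> Vfin; apply: contrapT => /forallNP unb.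
pose F n := V `&` ~` `[(- n%:R)%R, n%:R].
have mF n : measurable (F n) by apply: measurableI => //; apply: measurableC.
have : mu \o F @ \oo --> mu (\bigcap_n F n).
  apply: nonincreasing_cvg_mu => //.
  - apply: le_lt_trans Vfin; apply: le_measure; rewrite ?inE//.
    by apply: subIset; left.
  - exact: bigcapT_measurable.
  - apply/nonincreasing_seqP => n; rewrite subsetEset; apply: setIS.
    apply: subsetC => t; rewrite /= !in_itv/= -!ler_norml => /le_trans; apply.
    by rewrite ler_nat.
rewrite (_ : \bigcap_n F n = set0) ?measure0; last first.
  rewrite -subset0 => t /(_ (Num.bound t) I)[_]; apply.
  rewrite /= in_itv/= -ler_norml ltW// (lt_le_trans (archi_boundP (normr_ge0 t)))//.
  by rewrite /Num.bound normr_id.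
move=> /fine_cvgP[_ /cvgrPdist_lt/(_ 1%R ltr01)] /filter_ex[n].
(* The index is [n.+1] because points of ]-s, 1 - s[ are within 1 of -s and must still lie outside
   [-n, n]. *)
have {unb} /existsNP[s /not_implyP[ns /negP]] := unb n.+1; rewrite -ltNge => ys.
apply/negP; rewrite sub0r normrN -leNgt ger0_norm ?fine_ge0//.
have Fnfin : mu (F n) \is a fin_num.
  rewrite ge0_fin_numE//; apply: le_lt_trans Vfin; apply: le_measure; rewrite ?inE//.
  by apply: subIset; left.
rewrite -lee_fin fineK//.
apply: (@le_trans _ _ (mu `](- s)%R, (1 - s)%R[%classic)).
  rewrite lebesgue_measure_itv/= lte_fin ifT; last by lra.
  by rewrite -EFinB lee_fin; lra.
apply: le_measure; rewrite ?inE//.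
move=> t; rewrite /= in_itv/= => /andP[st ts]; split.
  by exists (s + t)%R; rewrite /= ?in_itv/= ?addrK//; apply/andP; split; lra.
rewrite /= in_itv/= -ler_norml; apply/negP; rewrite -ltNge.
have := @ler_normB _ R (s + t)%R t; rewrite addrK.
have : (`|s + t| < 1)%R by rewrite ltr_norml; apply/andP; split; lra.
by move: ns; rewrite -natr1; lra.
Qed.

(** Shifting by t in ]0, 1[ moves the exceedance at 0 to t, inside the unit window. This lower bound
    lets the mean of 1 / E be compared with the transported integral. *)
Lemma unit_exceedance_orbit_ge1 y : exceed0 N y ->
  1 <= orbit_integral unit_exceedance_indic y.
Proof.
move=> y1; rewrite /orbit_integral.
have -> : 1 = \int[mu]_t (\1_`]0%R, 1%R[%classic (t : measurableTypeR R) : R)%:E.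
  transitivity (mu `]0%R, 1%R[%classic); last by rewrite integral_indicT.
  by rewrite lebesgue_measure_itv/= lte_fin ltr01 oppr0 adde0.
apply: ge0_le_integral => //.
- by apply/measurable_EFinP; exact: measurable_indic.
- exact: measurable_orbit1 measurable_unit_exceedance_indic y.
- move=> t _; rewrite lee_fin !indicE ler_nat.
  have [|//] := boolP (t \in _); rewrite inE/= => t01.
  rewrite mem_set//; exists t => //=.
  by rewrite subrr.
Qed.

Hypothesis exceed_finite : nu ([set y | exceed N y = +oo] `&` exceed0 N) = 0.

Lemma measurable_exceed_infinite : measurable [set y : cadlag R d | exceed N y = +oo].
Proof.
rewrite (_ : [set y | _] = [set: cadlag R d] `&` exceed N @^-1` [set +oo]) ?setTI//.
by rewrite -[X in measurable X]setTI; apply: measurable_exceed.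
Qed.

Lemma tail_null_exceed_infinite : nu [set y | exceed N y = +oo] = 0.
Proof.
have mA := measurable_exceed_infinite.
rewrite -(@tail_null_exceeding [set y | exceed N y = +oo])//; last first.
  by move=> t y /=; rewrite exceed_shift.
congr (nu _); apply/seteqP; split => [y /= yy|y []//].
by split => //; apply/(exceed_gt0P N_norm); rewrite yy.
Qed.

Lemma integral_reciprocal_unit_exceedance :
  \int[nu]_y ((reciprocal_exceed y)%:E * orbit_integral unit_exceedance_indic y) < +oo.
Proof.
have mk : measurable_fun setT (fun y => (reciprocal_exceed y)%:E).
  by apply/measurable_EFinP; exact: measurable_reciprocal_exceed.
have k0 y : 0 <= (reciprocal_exceed y)%:E by rewrite lee_fin reciprocal_exceed_ge0.
rewrite -mass_transport//; [|exact: measurable_unit_exceedance_indic|exact: unit_exceedance_indic_ge0].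
apply: le_lt_trans unit_exceedance_lty.
rewrite -integral_indicT; last exact: measurable_unit_exceedance.
apply: ge0_le_integral => //.
- by move=> y _; rewrite mule_ge0// ?orbit_integral_ge0 ?lee_fin.
- apply: emeasurable_funM; first exact: measurable_unit_exceedance_indic.
  exact: measurable_orbit_integral.
- exact: measurable_unit_exceedance_indic.
- move=> y _; rewrite -[leRHS]mule1 lee_wpmul2l ?lee_fin//.
  have [yy|/eqP yfin] := pselect (exceed N y = +oo); last first.
    rewrite orbit_reciprocal_exceed ?ltey//.
    by rewrite indicE lee_fin; case: (_ \in _).
  (* If E = +oo, the default value makes the weight vanish along the whole orbit, so the bound by 1
     holds for such paths too. *)
  rewrite /orbit_integral integral0_eq ?lee_fin// => t _.
  by rewrite /reciprocal_exceed exceed_shift// yy invr0 mulr0.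
Qed.

Lemma integral_reciprocal_lty : \int[nu]_y (reciprocal_exceed y)%:E < +oo.
Proof.
have mk : measurable_fun setT (fun y => (reciprocal_exceed y)%:E).
  by apply/measurable_EFinP; exact: measurable_reciprocal_exceed.
have k0 y : 0 <= (reciprocal_exceed y)%:E by rewrite lee_fin reciprocal_exceed_ge0.
have mO : measurable_fun setT (orbit_integral unit_exceedance_indic).
  by apply: measurable_orbit_integral; [exact: measurable_unit_exceedance_indic|exact: unit_exceedance_indic_ge0].
have O0 y : 0 <= orbit_integral unit_exceedance_indic y.
  by apply: orbit_integral_ge0; exact: unit_exceedance_indic_ge0.
apply: le_lt_trans integral_reciprocal_unit_exceedance.
apply: ge0_le_integral => //.
- exact: emeasurable_funM.
- move=> y _; rewrite /reciprocal_exceed indicE.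
  have [|_] := boolP (y \in _); last by rewrite mul0r mul0e.
  rewrite inE => /unit_exceedance_orbit_ge1 y1.
  by rewrite -[leLHS]mule1 lee_wpmul2l// lee_fin mul1r invr_ge0 fine_ge0// exceed_ge0.
Qed.

Lemma reciprocal_exceed_gt0 y : exceed0 N y -> exceed N y <> +oo ->
  (0 < reciprocal_exceed y)%R.
Proof.
move=> y1 yfin; rewrite /reciprocal_exceed indicE mem_set// mul1r invr_gt0.
by rewrite fine_gt0// (exceed_gt0 N_norm y1)/= ltey; apply/eqP.
Qed.

(** Otherwise G would be covered by two null sets, where the weight is positive and where E is
    infinite, against nu(G) = 1. *)
Lemma integral_reciprocal_gt0 : 0 < \int[nu]_y (reciprocal_exceed y)%:E.
Proof.
have mk : measurable_fun setT (fun y => (reciprocal_exceed y)%:E).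
  by apply/measurable_EFinP; exact: measurable_reciprocal_exceed.
have k0 y : 0 <= (reciprocal_exceed y)%:E by rewrite lee_fin reciprocal_exceed_ge0.
have I0 : 0 <= \int[nu]_y (reciprocal_exceed y)%:E by apply: integral_ge0 => y _; exact: k0.
rewrite lt_def I0 andbT.
apply/eqP => /(ge0_integral_eq0_null mk k0) nu0.
have [_ _ nuG _] := nu_tail.
have : nu (exceed0 N) = 0.
  apply: (@measure0_subset _ _ _ nu _ ([set y | 0 < (reciprocal_exceed y)%:E] `|`
     [set y | exceed N y = +oo])).
  - exact: measurable_exceed0.
  - apply: measurableU; last exact: measurable_exceed_infinite.
    by rewrite -[X in measurable X]setTI; exact: emeasurable_fun_o_infty.
  - move=> y y1; have [yy|yy] := pselect (exceed N y = +oo); [by right|left].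
    by rewrite /= lte_fin reciprocal_exceed_gt0.
  - apply: measure0_setU => //; [|exact: measurable_exceed_infinite|exact: tail_null_exceed_infinite].
    by rewrite -[X in measurable X]setTI; exact: emeasurable_fun_o_infty.
by rewrite nuG => /eqP; rewrite onee_eq0.
Qed.

End tail_measures.

(** * Spectral decomposition along rays *)

Section spectral_decomposition.
Context (R : realType) (d : nat) (N : 'rV[R]_d -> R) (N_norm : is_norm N).
Context (alpha : R) (alpha_gt0 : (0 < alpha)%R).
Variable nu : {measure set (cadlag R d) -> \bar R}.
Hypotheses (nu_tail : tail_measure N alpha nu) (nu_shift : shift_invariant nu).
Hypothesis exceed_finite : nu ([set y | exceed N y = +oo] `&` exceed0 N) = 0.
Local Notation mu := (@lebesgue_measure R).
Implicit Types (y z : cadlag R d).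
Let re := reciprocal_exceed N.

Let mre : measurable_fun setT (fun y => (re y)%:E).
Proof. by apply/measurable_EFinP; exact: measurable_reciprocal_exceed. Qed.
Let re0 y : 0 <= (re y)%:E.
Proof. by rewrite lee_fin reciprocal_exceed_ge0. Qed.

Lemma tail_null_D0 : nu (~` D0 N) = 0.
Proof.
pose O := orbit_integral (unit_exceedance_indic N).
have mO : measurable_fun setT O.
  by apply: measurable_orbit_integral; [exact: measurable_unit_exceedance_indic|exact: unit_exceedance_indic_ge0].
have O0 y : 0 <= O y by apply: orbit_integral_ge0; exact: unit_exceedance_indic_ge0.
have moo (f : cadlag R d -> \bar R) : measurable_fun setT f -> measurable [set y | f y = +oo].
  move=> mf; rewrite (_ : [set y | _] = [set: cadlag R d] `&` f @^-1` [set +oo]) ?setTI//.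
  by rewrite -[X in measurable X]setTI; apply: mf.
pose A := [set y | O y = +oo].
have mA : measurable A by exact: moo.
have mE : measurable [set y | exceed N y = +oo] by apply: moo; exact: measurable_exceed.
have As t y : A y -> A (cadlag_shift t y).
  rewrite /A/= /O orbit_integral_shift//; [exact: measurable_unit_exceedance_indic|exact: unit_exceedance_indic_ge0].
have mreO : measurable_fun setT (fun y => (re y)%:E * O y) by exact: emeasurable_funM.
(* Where E is finite, a path of A in G has a positive weight and infinite [O], hence an infinite
   product; the product has finite integral. *)
have AG0 : nu (A `&` exceed0 N) = 0.
  have mB := moo _ mreO.
  have mG := measurable_exceed0 N_norm.
  apply: (@measure0_subset _ _ _ nu _ ([set y | (re y)%:E * O y = +oo] `|`
     [set y | exceed N y = +oo])) => //.
  - exact: measurableI.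
  - exact: measurableU.
  - move=> y [Ay y1]; have [yy|yy] := pselect (exceed N y = +oo); [by right|left].
    rewrite /= Ay gt0_muley// lte_fin; exact: reciprocal_exceed_gt0.
  - apply: measure0_setU => //; last exact: (tail_null_exceed_infinite N_norm nu_tail nu_shift exceed_finite).
    apply: ge0_integral_lty_null => //; first by move=> y; rewrite mule_ge0.
    exact: (integral_reciprocal_unit_exceedance N_norm nu_tail nu_shift).
(* A is shift-invariant, and a path that never exceeds 1 has [O] equal to 0, so A lies in the set
   y^* > 1. *)
have A0 : nu A = 0.
  rewrite -(tail_null_exceeding N_norm nu_tail nu_shift mA As AG0); congr (nu _).
  apply/seteqP; split => [y Ay|y []//]; split => //=.
  rewrite ltNge; apply/negP => y1; move: Ay; rewrite /A/= /O /orbit_integral integral0_eq//.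
  move=> t _; rewrite /unit_exceedance_indic indicE memNset// => -[s _ /=].
  by apply/negP; rewrite -leNgt -lee_fin (le_trans (sup_norm_ub N y _)).
(* Level 1/(n+1) for y is level 1 for (n+1) y, and homogeneity keeps these preimages null. *)
pose F (n : nat) := cadlag_scale (n.+1%:R : R) @^-1` A.
have mF n : measurable (F n) by rewrite -[X in measurable X]setTI; exact: measurable_scale.
apply: (@measure0_subset _ _ _ nu _ (\bigcup_n F n)).
- by apply: measurableC; exact: measurable_D0.
- exact: bigcupT_measurable.
- move=> y; apply: contra_notP => /= yF; apply/(D0P N_norm) => n.
  have : O (cadlag_scale n.+1%:R y) < +oo.
    rewrite ltey; apply/eqP => Oy; apply: yF; exists n => //.
  move=> /(orbit_unit_exceedance_bounded N_norm)[m mP]; exists m => s /mP.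
  by rewrite (cadlag_norm_scale N_norm) ger0_norm// -ler_pdivlMl// mulr1.
- apply: measure0_bigcup => // n; rewrite /F.
  by rewrite (tail_scale nu_tail)// A0 mule0.
Qed.

Definition norm_sup y : R := fine (sup_norm N y).

Let msup : measurable_fun setT norm_sup.
Proof. by apply: measurableT_comp => //; exact: measurable_sup_norm. Qed.

Lemma norm_supE y : sup_norm N y < +oo -> sup_norm N y = (norm_sup y)%:E.
Proof. by move=> yfin; rewrite fineK// ge0_fin_numE// sup_norm_ge0. Qed.

Lemma norm_sup_scale u y : (0 < u)%R -> sup_norm N y < +oo ->
  norm_sup (cadlag_scale u y) = (u * norm_sup y)%R.
Proof. by move=> u0 /norm_supE yE; rewrite /norm_sup sup_norm_scale// yE. Qed.

(** Off this null set y^* is positive and finite, so [norm_sup] and [normalize] take no default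
    value. *)
Let bad := ~` D0 N `|` [set (cadlag0 : cadlag R d)].
Let mbad : measurable bad.
Proof.
apply: measurableU; first by apply: measurableC; exact: measurable_D0.
exact: measurable_cadlag0 N_norm.
Qed.
Let bad0 : nu bad = 0.
Proof.
apply: measure0_setU; [by apply: measurableC; exact: measurable_D0|exact: measurable_cadlag0 N_norm| |].
  exact: tail_null_D0.
exact: tail_null0 nu_tail.
Qed.
Let goodP y : ~ bad y -> [/\ D0 N y, sup_norm N y < +oo & (0 < norm_sup y)%R].
Proof.
move=> /not_orP[/contrapT yD y0]; have yfin := D0_sup_norm N_norm yD; split => //.
rewrite -lte_fin -norm_supE// lt_def sup_norm_ge0// andbT.
by apply/eqP => /(sup_norm_eq0 N_norm).
Qed.

Definition ray_mass (A : set (cadlag R d)) z : \bar R :=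
  \int[mu]_u ((\1_A (cadlag_scale u (normalize N z)))%:E * (pareto_density alpha u)%:E).

Section ray.
Variables (A : set (cadlag R d)) (mA : measurable A).

Let f (p : measurableTypeR R * cadlag R d) : \bar R := (\1_A (cadlag_scale p.1 p.2))%:E.
Let mf : measurable_fun setT f.
Proof.
apply/measurable_EFinP.
exact: measurableT_comp (measurable_indic mA) measurable_cadlag_scale.
Qed.
Let mp : measurable_fun setT (fun u : measurableTypeR R => (pareto_density alpha u)%:E).
Proof. by apply/measurable_EFinP; exact: measurable_pareto_density. Qed.
Let p0 u : 0 <= (pareto_density alpha u)%:E.
Proof. by rewrite lee_fin pareto_density_ge0. Qed.
Let f0 p : 0 <= f p. Proof. by rewrite lee_fin. Qed.

Let fp (p : measurableTypeR R * cadlag R d) := f p * (pareto_density alpha p.1)%:E.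
Let mfp : measurable_fun setT fp.
Proof. by apply: emeasurable_funM => //; exact: measurableT_comp mp measurable_fst. Qed.
Let fp0 p : 0 <= fp p. Proof. by rewrite mule_ge0. Qed.

Lemma ray_mass_ge0 z : 0 <= ray_mass A z.
Proof. by apply: integral_ge0 => u _; rewrite mule_ge0// lee_fin. Qed.

Lemma measurable_ray_mass : measurable_fun setT (ray_mass A).
Proof.
have := measurable_fun_fubini_tonelli_G (m1 := mu) fp mfp fp0.
by move=> /measurableT_comp/(_ (measurable_normalize N_norm)).
Qed.

Lemma ray_mass_shift t z : ray_mass A (cadlag_shift t z) =
  \int[mu]_u ((\1_A (cadlag_scale u (cadlag_shift t (normalize N z))))%:E * (pareto_density alpha u)%:E).
Proof. by rewrite /ray_mass normalize_shift. Qed.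

(** Homogeneity of the Pareto measure replaces the normalized path by z itself, at the cost of a
    power of its supremum. *)
Lemma ray_massE z : ~ bad z -> ray_mass A z =
  (norm_sup z `^ (- alpha))%:E *
    \int[mu]_u ((\1_A (cadlag_scale u z))%:E * (pareto_density alpha u)%:E).
Proof.
move=> /goodP[_ _ z0].
rewrite powRN -powR_inv1 ?powR_ge0// -powRrM mulrC powRrM powR_inv1 ?ltW//.
rewrite -(integral_pareto_scale alpha_gt0 (f := fun u => f (u, z))) ?invr_gt0//.
- apply: eq_integral => u _; congr (_ * _); rewrite /f/=; congr (\1_A _)%:E.
  by rewrite /normalize -/(norm_sup z) cadlag_scaleM mulrC.
- exact: measurableT_comp mf (measurable_pair2 z).
Qed.

(** By [ray_massE], this is the factor left in front of the integral over u once the restriction to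
    y^* > 1 is included. *)
Let g y : R := if (1 < norm_sup y)%R then (norm_sup y `^ (- alpha))%R else 0%R.
Let mg : measurable_fun setT (fun y => (g y)%:E).
Proof.
apply/measurable_EFinP; apply: measurable_fun_ifT => //.
- by apply: measurable_fun_ltr => //; exact: measurable_cst.
- exact: measurableT_comp (measurable_powR _) msup.
Qed.
Let g0 y : 0 <= (g y)%:E.
Proof. by rewrite lee_fin /g; case: ifPn => // _; rewrite powR_ge0. Qed.

(** A polar decomposition obtained without constructing an angular measure. Write s for
    [norm_sup z]. For fixed u, homogeneity replaces z by z / u: this yields a factor u^alpha, and
    g(z / u) = u^alpha s^(-alpha) when u < s, and 0 otherwise. With the Pareto density the weight of
    z becomes s^(-alpha) alpha u^(alpha-1) on ]0, s[, whose integral in u is 1. *)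
Lemma integral_ray_mass :
  \int[nu]_z (ray_mass A z * (\1_[set y | (1 < sup_norm N y)%E] z)%:E) = nu A.
Proof.
transitivity (\int[nu]_z \int[mu]_u ((g z)%:E * fp (u, z))).
  apply: (ge0_eq_integral_off_null mbad bad0).
  - apply: emeasurable_funM; first exact: measurable_ray_mass.
    apply/measurable_EFinP; apply: measurable_indic.
    rewrite -[X in measurable X]setTI.
    by apply: emeasurable_fun_o_infty => //; exact: measurable_sup_norm.
  - have mgfp : measurable_fun setT (fun p : measurableTypeR R * cadlag R d => (g p.2)%:E * fp p).
      by apply: emeasurable_funM => //; exact: measurableT_comp mg measurable_snd.
    apply: (measurable_fun_fubini_tonelli_G (m1 := mu) _ mgfp) => p.
    by rewrite mule_ge0.
  - by move=> z; rewrite mule_ge0 ?ray_mass_ge0 ?lee_fin.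
  - by move=> z; apply: integral_ge0 => u _; rewrite mule_ge0.
  - move=> z zb; have [zD zfin z0] := goodP zb.
    rewrite ge0_integralZl//; last exact: measurableT_comp mfp (measurable_pair2 z).
    rewrite ray_massE// /g indicE.
    have [|/negP] := boolP (z \in _); rewrite inE/= norm_supE// lte_fin.
      by move=> ->; rewrite mule1.
    by case: ifPn => // _ _; rewrite mule0 mul0e.
pose F1 (p : cadlag R d * measurableTypeR R) := (g p.1)%:E * fp (p.2, p.1).
have mswap : measurable_fun setT (fun p : cadlag R d * measurableTypeR R => (p.2, p.1)).
  by apply/measurable_fun_pairP; split => /=; [exact: measurable_snd|exact: measurable_fst].
have mF1 : measurable_fun setT F1.
  by apply: emeasurable_funM; [exact: measurableT_comp mg measurable_fst|exact: measurableT_comp mfp mswap].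
rewrite (sigma_finite_tonelli (f := F1) _ (tail_sigma_finite N_norm nu_tail))//; last first.
  by move=> p; rewrite mule_ge0.
pose F2 (p : cadlag R d * measurableTypeR R) : \bar R :=
  (\1_A p.1)%:E * (norm_sup p.1 `^ (- alpha))%:E *
  ((\1_`]0%R, norm_sup p.1[%classic p.2)%:E * (alpha * p.2 `^ (alpha - 1))%:E).
have F20 p : 0 <= F2 p.
  by rewrite /F2 !mule_ge0 ?lee_fin ?powR_ge0// mulr_ge0 ?powR_ge0// ltW.
have mF2 : measurable_fun setT F2.
  apply: emeasurable_funM; apply: emeasurable_funM; apply/measurable_EFinP.
  - exact: measurableT_comp (measurable_indic mA) measurable_fst.
  - exact: measurableT_comp (measurable_powR _) (measurableT_comp msup measurable_fst).
  - rewrite (_ : (fun _ => _) = \1_([set p : cadlag R d * measurableTypeR R | (0 < p.2)%R] `&`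
        [set p | (p.2 < norm_sup p.1)%R])).
      apply: measurable_indic; apply: measurableI; apply: measurable_set_ltr.
      + exact: measurable_cst.
      + exact: measurable_snd.
      + exact: measurable_snd.
      + exact: measurableT_comp msup measurable_fst.
    apply/funext => p; rewrite !indicE; congr (nat_of_bool _)%:R.
    by apply/idP/idP; rewrite !inE/= in_itv/= => /andP.
  - apply: measurable_funM => //; apply: measurableT_comp (measurable_powR _) measurable_snd.
transitivity (\int[mu]_u \int[nu]_z F2 (z, u)).
  apply: eq_integral => u _.
  have mF2u : measurable_fun setT (fun z => F2 (z, u)).
    exact: measurableT_comp mF2 (measurable_pair2 u).
  have [u0|u0] := ltP 0%R u; last first.
    transitivity (0 : \bar R); [|apply: esym]; apply: integral0_eq => z _.
      rewrite /F1 /fp /= /pareto_density; case: ifPn => [|_]; last by rewrite !mule0.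
      by rewrite ltNge u0.
    rewrite /F2/= [\1_`]0%R, _[%classic _]indicE memNset ?mul0e ?mule0//= in_itv/=.
    by move=> /andP[]; rewrite ltNge u0.
  pose G z := ((g (cadlag_scale u^-1 z))%:E * (\1_A z)%:E) * (pareto_density alpha u)%:E.
  have mG : measurable_fun setT G.
    apply: emeasurable_funM; last exact: measurable_cst.
    apply: emeasurable_funM; first exact: measurableT_comp mg (measurable_scale _).
    by apply/measurable_EFinP; exact: measurable_indic.
  have G0 z : 0 <= G z by rewrite /G !mule_ge0// lee_fin.
  transitivity (\int[nu]_z G (cadlag_scale u z)).
    apply: eq_integral => z _.
    by rewrite /G cadlag_scaleM mulVf ?gt_eqF// cadlag_scale1 -muleA.
  rewrite (integral_scale nu_tail)// -ge0_integralZl// ?lee_fin ?powR_ge0//.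
  apply: (ge0_eq_integral_off_null mbad bad0) => //.
  - exact: measurable_funeM.
  - by move=> z; rewrite mule_ge0// lee_fin powR_ge0.
  - move=> z zb; have [zD zfin z0] := goodP zb.
    rewrite /G /F2 /g norm_sup_scale ?invr_gt0// /pareto_density u0 /=.
    rewrite ltr_pdivlMl// mulr1 indicE [in RHS]indicE.
    have -> : (u \in `]0%R, norm_sup z[%classic) = (u < norm_sup z)%R.
      by apply/idP/idP; rewrite inE/= in_itv/= ?u0// => /andP[].
    case: ifPn => // _; last by rewrite !mul0e !mule0.
    rewrite mul1e -!EFinM; congr EFin.
    rewrite powRM ?invr_ge0 ?ltW// -powR_inv1 ?ltW// -powRrM mulrNN mul1r.
    rewrite [(u `^ (_ - 1))%R]powRB; last by rewrite (gt_eqF u0) implybT.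
    rewrite [(u `^ (alpha - 1))%R]powRB; last by rewrite (gt_eqF u0) implybT.
    rewrite powRr1 ?ltW// [(u `^ (- _))%R]powRN.
    by field; rewrite !gt_eqF ?powR_gt0.
rewrite -(sigma_finite_tonelli (f := F2) _ (tail_sigma_finite N_norm nu_tail))//.
rewrite -integral_indicT//; apply: (ge0_eq_integral_off_null mbad bad0) => //.
- exact: (measurable_fun_fubini_tonelli_F (m2 := mu) F2 mF2 F20).
- by apply/measurable_EFinP; exact: measurable_indic.
- by move=> z; apply: integral_ge0.
- move=> z zb; have [zD zfin z0] := goodP zb.
  rewrite /F2/= ge0_integralZl//.
  - rewrite integral_power0x// -!EFinM -mulrA -powRD; last by rewrite (gt_eqF z0) implybT.
    by rewrite addNr powRr0 mulr1.
  - apply: emeasurable_funM; apply/measurable_EFinP; first exact: measurable_indic.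
    by apply: measurable_funM => //; exact: measurable_powR.
  - by move=> v _; rewrite mule_ge0 ?lee_fin// mulr_ge0 ?powR_ge0// ltW.
  - by rewrite mule_ge0 ?lee_fin ?powR_ge0.
Qed.

End ray.

End spectral_decomposition.

(** * Consequences of a moving shift representation *)

Lemma integral_pareto_density (R : realType) (alpha : R) (X : R -> \bar R) :
  \int[lebesgue_measure]_(u in `]0%R, +oo[) (X u * (alpha * u `^ (- alpha - 1))%:E) =
  \int[lebesgue_measure]_u (X u * (pareto_density alpha u)%:E).
Proof.
rewrite integral_mkcond; apply: eq_integral => u _; rewrite patchE /pareto_density.
have -> : (u \in `]0%R, +oo[%classic) = (0 < u)%R.
  by apply/idP/idP; rewrite inE/= in_itv/= andbT.
by case: ifPn => // _; rewrite mule0.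
Qed.

Section representation.
Context (R : realType) (d : nat) (N : 'rV[R]_d -> R) (N_norm : is_norm N).
Context (alpha : R) (alpha_gt0 : (0 < alpha)%R).
Variable nu : {measure set (cadlag R d) -> \bar R}.
Local Notation mu := (@lebesgue_measure R).
Implicit Types (y z : cadlag R d).

(** Tonelli: at a fixed time t, the Pareto mass of the u with u |y_t| > 1 is |y_t|^alpha. *)
Lemma pareto_orbit_exceed0 y :
  \int[mu]_u (orbit_integral (exceed0_indic N) (cadlag_scale u y) *
    (pareto_density alpha u)%:E) = orbit_integral (path_power N alpha) y.
Proof.
have mp : measurable_fun setT (fun u : measurableTypeR R => (pareto_density alpha u)%:E).
  by apply/measurable_EFinP; exact: measurable_pareto_density.
pose f (p : measurableTypeR R * measurableTypeR R) : \bar R :=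
  exceed0_indic N (cadlag_scale p.1 (cadlag_shift p.2 y)) * (pareto_density alpha p.1)%:E.
have mf : measurable_fun setT f.
  apply: emeasurable_funM; last exact: measurableT_comp mp measurable_fst.
  apply: measurableT_comp (measurable_exceed0_indic N_norm) _.
  apply: (measurableT_comp measurable_cadlag_scale
    (g := fun p : measurableTypeR R * measurableTypeR R => (p.1, cadlag_shift p.2 y))).
  apply/measurable_fun_pairP; split => /=; first exact: measurable_fst.
  apply: (measurableT_comp measurable_cadlag_shift
    (g := fun p : measurableTypeR R * measurableTypeR R => (p.2, y))).
  by apply/measurable_fun_pairP; split => /=; [exact: measurable_snd|exact: measurable_cst].
have f0 p : 0 <= f p by rewrite mule_ge0 ?lee_fin ?pareto_density_ge0.
transitivity (\int[mu]_u \int[mu]_t f (u, t)).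
  apply: eq_integral => u _; rewrite /f/= -ge0_integralZr//.
  - exact: measurable_orbit1 (measurable_exceed0_indic N_norm) _.
  - by move=> t _; exact: exceed0_indic_ge0.
  - by rewrite lee_fin pareto_density_ge0.
rewrite (@fubini_tonelli _ _ _ _ _ mu mu f)//.
apply: eq_integral => t _; rewrite /path_power -(integral_pareto_tail alpha_gt0) ?(is_norm_ge0 N_norm)//.
apply: eq_integral => u _; rewrite /f/=.
have [u0|u0] := ltP 0%R u; last by rewrite /pareto_density ltNge u0 !mule0.
rewrite exceed0_indicE cadlag_norm_scale// gtr0_norm// indicE.
by congr ((nat_of_bool _)%:R%:E * _); apply/idP/idP; rewrite inE.
Qed.

Section moving_shift.
Variables (theta : R) (dQ : measure_display) (OmegaQ : measurableType dQ).
Variables (PQ : probability OmegaQ R) (Q : {mfun OmegaQ >-> cadlag R d}).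

(** The representation says that nu is the image under this map of the product of time, Pareto
    measure and law on [OmegaQ], multiplied by theta. *)
Let Phi (p : measurableTypeR R * (measurableTypeR R * OmegaQ)) :=
  cadlag_scale p.2.1 (cadlag_shift p.1 (Q p.2.2)).
Let mPhi : measurable_fun setT Phi.
Proof.
have m2 : measurable_fun setT (fun p : measurableTypeR R * (measurableTypeR R * OmegaQ) => p.2).
  exact: measurable_snd.
apply: (measurableT_comp measurable_cadlag_scale
  (g := fun p : measurableTypeR R * (measurableTypeR R * OmegaQ) =>
    (p.2.1, cadlag_shift p.1 (Q p.2.2)))).
apply/measurable_fun_pairP; split => /=; first exact: measurableT_comp measurable_fst m2.
apply: (measurableT_comp measurable_cadlag_shift
  (g := fun p : measurableTypeR R * (measurableTypeR R * OmegaQ) => (p.1, Q p.2.2))).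
apply/measurable_fun_pairP; split => /=; first exact: measurable_fst.
apply: (measurableT_comp (measurable_funPT Q)).
exact: measurableT_comp measurable_snd m2.
Qed.
Let mp : measurable_fun setT (fun u : measurableTypeR R => (pareto_density alpha u)%:E).
Proof. by apply/measurable_EFinP; exact: measurable_pareto_density. Qed.
Let p0 u : 0 <= (pareto_density alpha u)%:E.
Proof. by rewrite lee_fin pareto_density_ge0. Qed.
Let mpp : measurable_fun setT (fun p : measurableTypeR R * (measurableTypeR R * OmegaQ) =>
  (pareto_density alpha p.2.1)%:E).
Proof.
apply: (measurableT_comp mp).
exact: measurableT_comp measurable_fst measurable_snd.
Qed.

Section product.
Variable m2 : {sigma_finite_measure set (measurableTypeR R * OmegaQ)%type -> \bar R}.
Hypothesis m2E : forall A, m2 A = (mu \x PQ) A.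

Section integrand.
Variable F : cadlag R d -> \bar R.
Hypotheses (mF : measurable_fun setT F) (F0 : forall y, 0 <= F y).

Lemma measurable_orbit_pareto : measurable_fun setT
  (fun p : measurableTypeR R * OmegaQ =>
     orbit_integral F (cadlag_scale p.1 (Q p.2)) * (pareto_density alpha p.1)%:E).
Proof.
apply: emeasurable_funM; last exact: measurableT_comp mp measurable_fst.
apply: (measurableT_comp (measurable_orbit_integral mF F0)).
apply: (measurableT_comp measurable_cadlag_scale
  (g := fun p : measurableTypeR R * OmegaQ => (p.1, Q p.2))).
apply/measurable_fun_pairP; split => /=; first exact: measurable_fst.
exact: measurableT_comp (measurable_funPT Q) measurable_snd.
Qed.

Lemma orbit_pareto_ge0 (p : measurableTypeR R * OmegaQ) :
  0 <= orbit_integral F (cadlag_scale p.1 (Q p.2)) * (pareto_density alpha p.1)%:E.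
Proof. by rewrite mule_ge0 ?orbit_integral_ge0. Qed.

Definition ray_orbit_integral w : \bar R :=
  \int[mu]_u (orbit_integral F (cadlag_scale u (Q w)) * (pareto_density alpha u)%:E).

Lemma measurable_ray_orbit_integral : measurable_fun setT ray_orbit_integral.
Proof.
exact: (measurable_fun_fubini_tonelli_G (m1 := mu) _ measurable_orbit_pareto orbit_pareto_ge0).
Qed.

Lemma ray_orbit_integral_ge0 w : 0 <= ray_orbit_integral w.
Proof. by apply: integral_ge0 => u _; exact: (orbit_pareto_ge0 (u, w)). Qed.

(** Time is integrated innermost here, which produces orbit integrals, whereas the representation
    integrates it outermost. The triple product integral is the common value that links the two
    orders. *)
Lemma integral_ray_orbit : \int[PQ]_w ray_orbit_integral w =
  \int[mu \x m2]_p (F (Phi p) * (pareto_density alpha p.2.1)%:E).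
Proof.
have mFP : measurable_fun setT (fun p => F (Phi p) * (pareto_density alpha p.2.1)%:E).
  by apply: emeasurable_funM => //; exact: measurableT_comp.
rewrite (@fubini_tonelli2 _ _ _ _ _ mu m2)//; last by move=> p; rewrite mule_ge0.
rewrite /fubini_G (eq_measure_integral (mu \x PQ)); last by move=> A _ _; exact: m2E.
rewrite -(fubini_tonelli2 (m1 := mu) (m2 := PQ) _ measurable_orbit_pareto orbit_pareto_ge0).
apply: eq_integral => -[u w] _ /=.
rewrite ge0_integralZr//=.
  congr (_ * _); apply: eq_integral => t _; rewrite /Phi/=.
  by rewrite cadlag_scale_shift.
by apply: measurableT_comp mF _; exact: measurableT_comp mPhi (measurable_pair2 _).
Qed.

End integrand.

Lemma integral_ray_orbit_iterated A : measurable A ->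
  \int[mu \x m2]_p ((\1_A (Phi p))%:E * (pareto_density alpha p.2.1)%:E) =
  \int[mu]_(t in [set: R]) \int[mu]_(u in `]0%R, +oo[)
    ((\int[PQ]_w \d_(cadlag_scale u (cadlag_shift t (Q w))) A) *
      (alpha * u `^ (- alpha - 1))%:E).
Proof.
move=> mA.
have mf : measurable_fun setT (fun p => (\1_A (Phi p))%:E * (pareto_density alpha p.2.1)%:E).
  apply: emeasurable_funM => //; apply/measurable_EFinP.
  exact: measurableT_comp (measurable_indic mA) mPhi.
have f0 p : 0 <= (\1_A (Phi p))%:E * (pareto_density alpha p.2.1)%:E.
  by apply: mule_ge0; [rewrite lee_fin|exact: p0].
rewrite (@fubini_tonelli1 _ _ _ _ _ mu m2)//; apply: eq_integral => t _; rewrite /fubini_F.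
rewrite (eq_measure_integral (mu \x PQ)); last by move=> B _ _; exact: m2E.
rewrite fubini_tonelli1//; last exact: measurableT_comp mf (measurable_pair1 t).
rewrite integral_pareto_density; apply: eq_integral => u _; rewrite /fubini_F/=.
rewrite ge0_integralZr//=.
apply/measurable_EFinP; apply: measurableT_comp (measurable_indic mA) _.
exact: measurableT_comp mPhi (measurableT_comp (measurable_pair1 t) (measurable_pair1 u)).
Qed.

End product.

Hypothesis rep : moving_shift_rep N alpha nu theta PQ Q.

(** Extends the representation from sets to functions, through the image under [Phi] with density
    theta times the Pareto density. *)
Lemma rep_integral F : measurable_fun setT F -> (forall y, 0 <= F y) ->
  \int[nu]_y F y = theta%:E * \int[PQ]_w ray_orbit_integral F w.
Proof.
move=> mF F0; have [th0 _ nuE] := rep.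
have [m2 m2E] := sigma_finite_product_probability mu PQ.
have mFP : measurable_fun setT (fun p => F (Phi p) * (pareto_density alpha p.2.1)%:E).
  by apply: emeasurable_funM => //; exact: measurableT_comp.
rewrite (@integral_image_density _ _ _ _ _ Phi (fun p => theta * pareto_density alpha p.2.1)%R mPhi
  _ _ (mu \x m2) nu _ F mF F0).
- rewrite (integral_ray_orbit m2E)// -ge0_integralZl ?lee_fin ?ltW//.
    by apply: eq_integral => p _; rewrite EFinM muleCA.
  by move=> p _; rewrite mule_ge0.
- by apply: measurable_funM => //; apply/measurable_EFinP.
- by move=> p; rewrite mulr_ge0 ?pareto_density_ge0// ltW.
- move=> A mA; rewrite nuE// -(integral_ray_orbit_iterated m2E)// -ge0_integralZl ?lee_fin ?ltW//.
  + by apply: eq_integral => p _; rewrite EFinM muleCA.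
  + apply: emeasurable_funM => //; apply/measurable_EFinP.
    exact: measurableT_comp (measurable_indic mA) mPhi.
  + by move=> p _; apply: mule_ge0; [rewrite lee_fin|exact: p0].
Qed.

Hypothesis nu_exceed0 : nu (exceed0 N) = 1.

Lemma rep_null_Dalpha : PQ [set w | ~ Dalpha N alpha (Q w)] = 0.
Proof.
have [th0 _ _] := rep.
have mpw : measurable_fun setT (fun w => orbit_integral (path_power N alpha) (Q w)).
  apply: measurableT_comp (measurable_funPT Q).
  by apply: measurable_orbit_integral; [exact: measurable_path_power|exact: path_power_ge0].
have pw0 w : 0 <= orbit_integral (path_power N alpha) (Q w).
  by apply: orbit_integral_ge0; exact: path_power_ge0.
have : theta%:E * \int[PQ]_w orbit_integral (path_power N alpha) (Q w) = 1.
  rewrite -nu_exceed0 -integral_indicT; last exact: measurable_exceed0.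
  rewrite -[RHS]/(\int[nu]_y exceed0_indic N y).
  rewrite (rep_integral (measurable_exceed0_indic N_norm) (exceed0_indic_ge0 N)).
  by congr (_ * _); apply: eq_integral => w _; rewrite /ray_orbit_integral pareto_orbit_exceed0.
move=> I1.
have If : \int[PQ]_w orbit_integral (path_power N alpha) (Q w) < +oo.
  rewrite ltey; apply/eqP => Ioo; move: I1; rewrite Ioo gt0_muley ?lte_fin//.
rewrite (_ : [set w | _] = [set w | orbit_integral (path_power N alpha) (Q w) = +oo]).
  exact: ge0_integral_lty_null.
apply/seteqP; split => w /=; rewrite DalphaE//.
  by move=> /negP; rewrite -leNgt leye_eq => /eqP.
by move=> ->; rewrite ltxx.
Qed.

Let mnD : measurable [set w | ~ Dalpha N alpha (Q w)].
Proof.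
rewrite -[X in measurable X]setTI.
apply: (measurable_funPT Q measurableT (~` Dalpha N alpha)).
by apply: measurableC; exact: measurable_Dalpha.
Qed.

(** D_alpha is stable under shifts and dilations, so it contains every u B^t Q as soon as it
    contains Q. *)
Lemma rep_tail_null_Dalpha : nu (~` Dalpha N alpha) = 0.
Proof.
have mD : measurable (~` Dalpha N alpha : set (cadlag R d)).
  by apply: measurableC; exact: measurable_Dalpha.
pose F y : \bar R := (\1_(~` Dalpha N alpha) y)%:E.
have mF : measurable_fun setT F by apply/measurable_EFinP; exact: measurable_indic.
have F0 y : 0 <= F y by rewrite lee_fin.
rewrite -integral_indicT// (rep_integral mF F0).
rewrite [X in _ * X](_ : _ = 0) ?mule0//.
transitivity (\int[PQ]_w cst 0 w); last by rewrite integral_cst// mul0e.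
apply: (ge0_eq_integral_off_null mnD rep_null_Dalpha) => //.
- exact: measurable_ray_orbit_integral.
- exact: ray_orbit_integral_ge0.
- move=> w /contrapT Dw; apply: integral0_eq => u _.
  rewrite /orbit_integral integral0_eq ?mul0e// => t _.
  have DQ := Dalpha_shift N_norm t (Dalpha_scale N_norm u Dw).
  by rewrite /F indicE memNset// => /(_ DQ).
Qed.

(** When Q^* = 1, normalizing u B^t Q gives back B^t Q, which lies in A exactly when Q does, by
    invariance of A. What remains is the orbit integral of the weight at uQ, the indicator of u > 1
    as E(uQ) is finite on D_alpha, and its Pareto mass is 1. *)
Lemma rep_spectral A : measurable A -> (forall t : R, cadlag_shift t @^-1` A = A) ->
  \int[nu]_y ((reciprocal_exceed N y)%:E * (\1_A (normalize N y))%:E) =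
  theta%:E * distribution PQ Q A.
Proof.
move=> mA As; have [th0 Q1 _] := rep.
pose F y := (reciprocal_exceed N y)%:E * (\1_A (normalize N y))%:E.
have mF : measurable_fun setT F.
  apply: emeasurable_funM; apply/measurable_EFinP; first exact: measurable_reciprocal_exceed.
  exact: measurableT_comp (measurable_indic mA) (measurable_normalize N_norm).
have F0 y : 0 <= F y by rewrite mule_ge0 ?lee_fin ?reciprocal_exceed_ge0.
rewrite (rep_integral mF F0); congr (_ * _).
have mQA : measurable (Q @^-1` A) by rewrite -[X in measurable X]setTI; exact: measurable_funPT.
rewrite /distribution /pushforward -integral_indicT//.
have mS : measurable [set w | sup_norm N (Q w) <> 1].
  rewrite (_ : [set w | _] = [set: OmegaQ] `&` (sup_norm N \o Q) @^-1` [set~ 1]) ?setTI//.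
  rewrite -[X in measurable X]setTI; apply: measurableT_comp => //; first exact: measurable_sup_norm.
  exact: measurableC.
have S0 : PQ [set w | sup_norm N (Q w) <> 1] = 0.
  apply/(probability_setC_eq1 PQ mS).
  transitivity (PQ [set w | sup_norm N (Q w) = 1]); last exact: Q1.
  congr (PQ _).
  by apply/seteqP; split => w /=; [exact: contrapT|move=> -> /(_ erefl)].
apply: (ge0_eq_integral_off_null (measurableU _ _ mnD mS)) => //.
- by apply: measure0_setU => //; exact: rep_null_Dalpha.
- exact: measurable_ray_orbit_integral.
- by apply/measurable_EFinP; exact: measurable_indic.
- exact: ray_orbit_integral_ge0.
- move=> w /not_orP[/contrapT Dw /contrapT w1].
  transitivity (\int[mu]_u ((\1_[set u : R | (1 < u * 1)%R] u)%:E * (pareto_density alpha u)%:E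
     * (\1_(Q @^-1` A) w)%:E)).
    apply: eq_integral => u _; have [u0|u0] := ltP 0%R u; last first.
      rewrite /pareto_density; case: ifPn => [|_]; first by rewrite ltNge u0.
      by rewrite !mule0 mul0e.
    rewrite -[RHS]muleA [X in _ = _ * X]muleC muleA; congr (_ * _).
    have -> : (\1_[set u : R | (1 < u * 1)%R] u)%:E =
        orbit_integral (fun z => (reciprocal_exceed N z)%:E) (cadlag_scale u (Q w)).
      rewrite orbit_reciprocal_exceed//; last first.
        by apply: (Dalpha_exceed N_norm alpha_gt0); exact: Dalpha_scale.
      rewrite !indicE; congr (nat_of_bool _)%:R%:E.
      by apply/idP/idP; rewrite !inE/= sup_norm_scale// w1 mule1 lte_fin mulr1.
    rewrite /orbit_integral -ge0_integralZr//.
    + apply: eq_integral => t _; rewrite /F normalize_shift normalize_scale//.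
      rewrite /normalize w1/= invr1 cadlag_scale1; congr (_ * _).
      rewrite !indicE; congr (nat_of_bool _)%:R%:E.
      apply/idP/idP; rewrite !inE/=; first by rewrite -{2}(As t).
      by rewrite -{1}(As t).
    + apply: (measurable_orbit1 (h := fun z => (reciprocal_exceed N z)%:E)).
      by apply/measurable_EFinP; exact: measurable_reciprocal_exceed.
    + by move=> t _; rewrite lee_fin reciprocal_exceed_ge0.
  rewrite ge0_integralZr ?lee_fin//.
  + by rewrite integral_pareto_tail// powR1 mul1e.
  + apply: emeasurable_funM => //; apply/measurable_EFinP; apply: measurable_indic.
    by apply: measurable_set_ltr => //; exact: measurable_funM.
  + by move=> u _; apply: mule_ge0; [rewrite lee_fin|exact: p0].
Qed.

End moving_shift.

End representation.

(** * Existence of the representation and the theorem *)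

Section existence.
Context (R : realType) (d : nat) (N : 'rV[R]_d -> R) (N_norm : is_norm N).
Context (alpha : R) (alpha_gt0 : (0 < alpha)%R).
Variable nu : {measure set (cadlag R d) -> \bar R}.
Hypotheses (nu_tail : tail_measure N alpha nu) (nu_shift : shift_invariant nu).
Hypothesis exceed_finite : nu ([set y | exceed N y = +oo] `&` exceed0 N) = 0.
Local Notation mu := (@lebesgue_measure R).
Implicit Types (y z : cadlag R d).
Let re := reciprocal_exceed N.

Let mre : measurable_fun setT (fun y => (re y)%:E).
Proof. by apply/measurable_EFinP; exact: measurable_reciprocal_exceed. Qed.
Let re0 y : 0 <= (re y)%:E.
Proof. by rewrite lee_fin reciprocal_exceed_ge0. Qed.

Lemma ray_orbit_mass A y : measurable A ->
  \int[mu]_u (orbit_integral (fun z => (\1_A z)%:E) (cadlag_scale u (normalize N y)) *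
    (pareto_density alpha u)%:E) = orbit_integral (ray_mass N alpha A) y.
Proof.
move=> mA.
have mp : measurable_fun setT (fun u : measurableTypeR R => (pareto_density alpha u)%:E).
  by apply/measurable_EFinP; exact: measurable_pareto_density.
have mA1 : measurable_fun setT (fun z => (\1_A z : R)%:E).
  by apply/measurable_EFinP; exact: measurable_indic.
pose f (p : measurableTypeR R * measurableTypeR R) : \bar R :=
  (\1_A (cadlag_scale p.1 (cadlag_shift p.2 (normalize N y))))%:E * (pareto_density alpha p.1)%:E.
have mf : measurable_fun setT f.
  apply: emeasurable_funM; last exact: measurableT_comp mp measurable_fst.
  apply: (measurableT_comp mA1).
  apply: (measurableT_comp measurable_cadlag_scale
    (g := fun p : measurableTypeR R * measurableTypeR R => (p.1, cadlag_shift p.2 (normalize N y)))).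
  apply/measurable_fun_pairP; split => /=; first exact: measurable_fst.
  apply: (measurableT_comp measurable_cadlag_shift
    (g := fun p : measurableTypeR R * measurableTypeR R => (p.2, normalize N y))).
  by apply/measurable_fun_pairP; split => /=; [exact: measurable_snd|exact: measurable_cst].
have f0 p : 0 <= f p by rewrite mule_ge0 ?lee_fin ?pareto_density_ge0.
transitivity (\int[mu]_u \int[mu]_t f (u, t)).
  apply: eq_integral => u _; rewrite /f/= -ge0_integralZr//.
  - by apply: eq_integral => t _; rewrite cadlag_scale_shift.
  - exact: (measurable_orbit1 (h := fun z => (\1_A z)%:E) mA1 _).
  - by rewrite lee_fin pareto_density_ge0.
rewrite (@fubini_tonelli _ _ _ _ _ mu mu f mf f0).
by apply: eq_integral => t _; rewrite ray_mass_shift.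
Qed.

Lemma integral_reciprocal_ray_mass A : measurable A ->
  \int[nu]_y ((re y)%:E * orbit_integral (ray_mass N alpha A) y) = nu A.
Proof.
move=> mA.
have mK := measurable_ray_mass N_norm alpha_gt0 mA.
have K0 z : 0 <= ray_mass N alpha A z by exact: ray_mass_ge0.
rewrite (mass_transport N_norm nu_tail nu_shift)//.
rewrite -(integral_ray_mass N_norm alpha_gt0 nu_tail nu_shift exceed_finite mA).
have mI : measurable [set y : cadlag R d | (1 < sup_norm N y)%E].
  rewrite -[X in measurable X]setTI.
  by apply: emeasurable_fun_o_infty => //; exact: measurable_sup_norm.
apply: (ge0_eq_integral_off_null (measurable_exceed_infinite N_norm)
  (tail_null_exceed_infinite N_norm nu_tail nu_shift exceed_finite)).
- by apply: emeasurable_funM => //; exact: measurable_orbit_integral.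
- by apply: emeasurable_funM => //; apply/measurable_EFinP; exact: measurable_indic.
- by move=> y; rewrite mule_ge0 ?orbit_integral_ge0.
- by move=> y; rewrite mule_ge0 ?lee_fin.
- by move=> y /= /eqP yfin; rewrite orbit_reciprocal_exceed// ltey.
Qed.

Lemma exists_moving_shift : exists (theta : R) (dQ : measure_display)
    (OmegaQ : measurableType dQ) (PQ : probability OmegaQ R)
    (Q : {mfun OmegaQ >-> cadlag R d}),
  [/\ moving_shift_rep N alpha nu theta PQ Q,
      theta%:E = \int[nu]_y (re y)%:E &
      forall A, measurable A -> distribution PQ Q A =
        (theta^-1)%:E * \int[nu]_y ((re y)%:E * (\1_A (normalize N y))%:E)].
Proof.
pose theta := fine (\int[nu]_y (re y)%:E).
have thE : theta%:E = \int[nu]_y (re y)%:E.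
  rewrite fineK// ge0_fin_numE; first exact: (integral_reciprocal_lty N_norm nu_tail nu_shift).
  by apply: integral_ge0 => y _; exact: re0.
have th0 : (0 < theta)%R.
  by rewrite -lte_fin thE; exact: (integral_reciprocal_gt0 N_norm nu_tail nu_shift exceed_finite).
pose w y : R := (re y / theta)%R.
have mw : measurable_fun setT w.
  by apply: measurable_funM => //; exact: measurable_reciprocal_exceed.
have w0 y : (0 <= w y)%R by rewrite divr_ge0 ?(ltW th0)// reciprocal_exceed_ge0.
have wint (f : cadlag R d -> \bar R) : measurable_fun setT f -> (forall y, 0 <= f y) ->
    \int[nu]_y (f y * (w y)%:E) = (theta^-1)%:E * \int[nu]_y ((re y)%:E * f y).
  move=> mf f0; rewrite -ge0_integralZl//.
  - by apply: eq_integral => y _; rewrite /w mulrC EFinM muleCA [f y * _]muleC.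
  - exact: emeasurable_funM.
  - by move=> y _; rewrite mule_ge0.
  - by rewrite lee_fin invr_ge0 ltW.
have w1 : \int[nu]_y (w y)%:E = 1.
  transitivity (\int[nu]_y (cst 1%:E y * (w y)%:E)).
    by apply: eq_integral => y _; rewrite mul1e.
  rewrite wint//.
  under eq_integral do rewrite mule1.
  by rewrite -thE -EFinM mulVf// gt_eqF.
(* Path space itself carries Q: the probability has density 1_G / (theta E) with respect to nu, and
   Q is normalization. *)
have [PQ PQE] := weighted_probability mw w0 w1.
pose Q : {mfun cadlag R d >-> cadlag R d} :=
  HB.pack (normalize N) (isMeasurableFun.Build _ _ _ _ (normalize N) (measurable_normalize N_norm)).
have PQint (f : cadlag R d -> \bar R) : measurable_fun setT f -> (forall y, 0 <= f y) ->
    \int[PQ]_y f y = (theta^-1)%:E * \int[nu]_y ((re y)%:E * f y).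
  move=> mf f0; rewrite -wint//.
  exact: (integral_image_density (@measurable_id _ _ _) mw w0 PQE).
have mA1 A : measurable A -> measurable_fun setT (fun z : cadlag R d => (\1_A z : R)%:E).
  by move=> mA; apply/measurable_EFinP; exact: measurable_indic.
exists theta, _, (cadlag R d), PQ, Q; split => //; last first.
  move=> A mA; have mQA : measurable (Q @^-1` A).
    by rewrite -[X in measurable X]setTI; exact: (measurable_normalize N_norm).
  by rewrite /distribution /pushforward -integral_indicT// PQint//; exact: mA1.
split => //.
- have mS : measurable [set y | sup_norm N (Q y) = 1].
    have mSQ : measurable_fun setT (sup_norm N \o normalize N).
      by apply: measurableT_comp; [exact: measurable_sup_norm|exact: measurable_normalize].
    have -> : [set y | sup_norm N (Q y) = 1] =
        [set: cadlag R d] `&` (sup_norm N \o normalize N) @^-1` [set 1] by rewrite setTI.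
    by apply: mSQ; [exact: measurableT|exact: emeasurable_set1].
  (* The density is carried by G, where y^* > 1, and y^* is finite on D_0; the normalized supremum
     is then 1. *)
  rewrite PQE//; transitivity (\int[nu]_y (w y)%:E); last exact: w1.
  apply: (ge0_eq_integral_off_null (measurableC (measurable_D0 N_norm))
    (tail_null_D0 N_norm nu_tail nu_shift exceed_finite)) => //.
  + by apply: emeasurable_funM; [exact: (mA1 _ mS)|exact/measurable_EFinP].
  + exact/measurable_EFinP.
  + by move=> y; rewrite mule_ge0 ?lee_fin.
  + move=> y /contrapT Dy; rewrite /w /re /reciprocal_exceed [\1_(exceed0 N) y]indicE.
    have [|_] := boolP (y \in _); last by rewrite !mul0r mule0.
    rewrite inE => y1; rewrite indicE mem_set ?mul1e//=.
    apply: (sup_norm_normalize N_norm); last exact: D0_sup_norm.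
    by rewrite (lt_trans lte01)//; apply/(exceed_gt0P N_norm)/(exceed_gt0 N_norm y1).
- move=> A mA.
  have [m2 m2E] := sigma_finite_product_probability mu PQ.
  rewrite -(integral_ray_orbit_iterated alpha_gt0 Q m2E mA).
  rewrite -(integral_ray_orbit alpha_gt0 Q m2E (mA1 _ mA)); last by move=> y; rewrite lee_fin.
  have A0 (y : cadlag R d) : 0 <= (\1_A y : R)%:E by rewrite lee_fin.
  rewrite PQint//; last 2 first.
  + exact: (measurable_ray_orbit_integral alpha_gt0 Q (mA1 _ mA) A0).
  + by move=> y; exact: ray_orbit_integral_ge0.
  rewrite muleA -EFinM mulfV ?gt_eqF// mul1e.
  rewrite -[LHS](integral_reciprocal_ray_mass mA); apply: eq_integral => y _.
  by rewrite -ray_orbit_mass.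
Qed.

End existence.

Section tail_process_law.
Context (R : realType) (d : nat) (N : 'rV[R]_d -> R) (N_norm : is_norm N).
Variable nu : {measure set (cadlag R d) -> \bar R}.
Context (dO : measure_display) (Omega : measurableType dO)
  (P : probability Omega R) (Y : {mfun Omega >-> cadlag R d}).
Hypothesis Y_tail : tail_process N nu P Y.

Lemma tail_process_integral (f : cadlag R d -> \bar R) :
  measurable_fun setT f -> (forall y, 0 <= f y) ->
  \int[P]_w f (Y w) = \int[nu]_y (f y * exceed0_indic N y).
Proof.
move=> mf f0; rewrite -(ge0_integral_distribution Y mf f0).
rewrite (@integral_image_density _ _ _ _ _ id (\1_(exceed0 N)) _ _ _ nu (distribution P Y))//.
- exact: measurable_indic (measurable_exceed0 N_norm).
- move=> A mA; rewrite [LHS](_ : _ = nu (A `&` exceed0 N)); last exact: Y_tail.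
  rewrite -integral_indicT; last first.
    by apply: measurableI => //; exact: measurable_exceed0.
  by apply: eq_integral => y _; rewrite indicI EFinM.
Qed.

(** Translates almost sure statements on Y into null sets inside G, the form of the standing
    hypothesis on E. *)
Lemma tail_process_as (B : set (cadlag R d)) : measurable B ->
  P [set w | B (Y w)] = 1 <-> nu (~` B `&` exceed0 N) = 0.
Proof.
move=> mB; rewrite -Y_tail; last exact: measurableC.
have mYB : measurable (Y @^-1` (~` B)).
  by rewrite -[X in measurable X]setTI; apply: measurable_funPT => //; exact: measurableC.
rewrite -(probability_setC_eq1 P mYB) (_ : ~` (Y @^-1` _) = [set w | B (Y w)])//.
by rewrite preimage_setC setCK.
Qed.

Lemma tail_process_reciprocal :
  \int[P]_w (exceed N (Y w))^-1 = \int[nu]_y (reciprocal_exceed N y)%:E.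
Proof.
have mE := measurable_inve (measurable_exceed N_norm) (exceed_ge0 (d := d) N_norm).
rewrite (tail_process_integral mE); last by move=> y; rewrite inve_ge0 exceed_ge0.
by apply: eq_integral => y _; rewrite reciprocal_exceedE// muleC.
Qed.

Lemma spectral_lawE theta A : measurable A -> spectral_law N theta P Y A =
  (theta^-1)%:E * \int[nu]_y ((reciprocal_exceed N y)%:E * (\1_A (normalize N y))%:E).
Proof.
move=> mA; rewrite /spectral_law; congr (_ * _).
have mE := measurable_inve (measurable_exceed N_norm) (exceed_ge0 (d := d) N_norm).
have mf : measurable_fun setT (fun y => (exceed N y)^-1 * (\1_A (normalize N y))%:E).
  apply: emeasurable_funM => //; apply/measurable_EFinP.
  exact: measurableT_comp (measurable_indic mA) (measurable_normalize N_norm).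
transitivity (\int[P]_w ((fun y => (exceed N y)^-1 * (\1_A (normalize N y))%:E) (Y w))).
  by apply: eq_integral => w _; rewrite diracE indicE.
rewrite (tail_process_integral mf); last first.
  by move=> y; rewrite mule_ge0 ?inve_ge0 ?exceed_ge0 ?lee_fin.
by apply: eq_integral => y _; rewrite reciprocal_exceedE// muleAC [_^-1 * _]muleC.
Qed.

End tail_process_law.

Theorem theorem2p9 (R : realType) (d : nat) (d_ge1 : (1 <= d)%N)
    (N : 'rV[R]_d -> R) (N_norm : is_norm N)
    (alpha : R) (alpha_gt0 : (0 < alpha)%R)
    (nu : {measure set (cadlag R d) -> \bar R})
    (nu_tail : tail_measure N alpha nu) (nu_shift : shift_invariant nu)
    (dO : measure_display) (Omega : measurableType dO)
    (P : probability Omega R) (Y : {mfun Omega >-> cadlag R d})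
    (Y_tail : tail_process N nu P Y) :
  let cond_i := exists (theta : R) (dQ : measure_display)
      (OmegaQ : measurableType dQ) (PQ : probability OmegaQ R)
      (Q : {mfun OmegaQ >-> cadlag R d}),
      moving_shift_rep N alpha nu theta PQ Q in
  [<-> cond_i;
       P [set w | D0 N (Y w)] = 1;
       P [set w | Dalpha N alpha (Y w)] = 1;
       P [set w | exceed N (Y w) < +oo] = 1;
       nu (~` D0 N) = 0;
       nu (~` Dalpha N alpha) = 0] /\
  (cond_i ->
    (forall (theta : R) (dQ : measure_display) (OmegaQ : measurableType dQ)
        (PQ : probability OmegaQ R) (Q : {mfun OmegaQ >-> cadlag R d}),
      moving_shift_rep N alpha nu theta PQ Q ->
      [/\ theta%:E = \int[P]_w (exceed N (Y w))^-1, (0 < theta)%R &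
        forall A, measurable A -> (forall t : R, cadlag_shift t @^-1` A = A) ->
          distribution PQ Q A = spectral_law N theta P Y A]) /\
    (exists (theta : R) (dQ : measure_display) (OmegaQ : measurableType dQ)
        (PQ : probability OmegaQ R) (Q : {mfun OmegaQ >-> cadlag R d}),
      [/\ moving_shift_rep N alpha nu theta PQ Q,
          theta%:E = \int[P]_w (exceed N (Y w))^-1 &
          forall A, measurable A ->
            distribution PQ Q A = spectral_law N theta P Y A])).
Proof.
move=> cond_i.
have nuG : nu (exceed0 N) = 1 by case: nu_tail.
have mG := measurable_exceed0 (d := d) N_norm.
have mD := measurable_D0 (d := d) N_norm.
have mDa := measurable_Dalpha (d := d) N_norm alpha.
have mE : measurable [set y : cadlag R d | exceed N y < +oo].
  rewrite -[X in measurable X]setTI.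
  by apply: emeasurable_fun_infty_o => //; exact: measurable_exceed.
have EC : ~` [set y : cadlag R d | exceed N y < +oo] = [set y | exceed N y = +oo].
  apply/seteqP; split => y /=; first by move=> /negP; rewrite -leNgt leye_eq => /eqP.
  by move=> ->; rewrite ltxx.
have iiP := tail_process_as Y_tail mD.
have iiiP := tail_process_as Y_tail mDa.
have ivP := tail_process_as Y_tail mE; rewrite EC in ivP.
have mC (B : set (cadlag R d)) : measurable B -> measurable (~` B `&` exceed0 N).
  by move=> mB; apply: measurableI => //; exact: measurableC.
have sub0 (B C : set (cadlag R d)) : measurable B -> measurable C -> B `<=` C ->
    nu (~` B `&` exceed0 N) = 0 -> nu (~` C `&` exceed0 N) = 0.
  move=> mB mC' BC; apply: measure0_subset; [exact: mC|exact: mC|].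
  by apply: setSI; exact: subsetC.
(* Condition (iv) is the hub: (ii) and (iii) imply it path by path, and it yields both the
   representation and the support in D_0. *)
have ii_iv : P [set w | D0 N (Y w)] = 1 -> P [set w | exceed N (Y w) < +oo] = 1.
  move=> /iiP/(sub0 _ _ mD mE) h; apply/ivP; rewrite -EC; apply: h => y.
  exact: D0_exceed.
have iii_iv : P [set w | Dalpha N alpha (Y w)] = 1 -> P [set w | exceed N (Y w) < +oo] = 1.
  move=> /iiiP/(sub0 _ _ mDa mE) h; apply/ivP; rewrite -EC; apply: h => y.
  exact: Dalpha_exceed.
have iv_i : P [set w | exceed N (Y w) < +oo] = 1 -> cond_i.
  move=> /ivP /(exists_moving_shift N_norm alpha_gt0 nu_tail nu_shift).
  by move=> [theta [dQ [OmegaQ [PQ [Q [rep _ _]]]]]]; exists theta, dQ, OmegaQ, PQ, Q.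
have i_vi : cond_i -> nu (~` Dalpha N alpha) = 0.
  move=> [theta [dQ [OmegaQ [PQ [Q rep]]]]].
  exact: (rep_tail_null_Dalpha N_norm alpha_gt0 rep nuG).
have iv_v : P [set w | exceed N (Y w) < +oo] = 1 -> nu (~` D0 N) = 0.
  by move=> /ivP /(tail_null_D0 N_norm nu_tail nu_shift).
have v_ii : nu (~` D0 N) = 0 -> P [set w | D0 N (Y w)] = 1.
  move=> D0n; apply/iiP; apply: measure0_subset D0n; [exact: mC|exact: measurableC|].
  by apply: subIset; left.
have vi_iii : nu (~` Dalpha N alpha) = 0 -> P [set w | Dalpha N alpha (Y w)] = 1.
  move=> Dn; apply/iiiP; apply: measure0_subset Dn; [exact: mC|exact: measurableC|].
  by apply: subIset; left.
have i_iv : cond_i -> P [set w | exceed N (Y w) < +oo] = 1 by move=> /i_vi/vi_iii/iii_iv.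
split.
  tfae.
  - by move=> /i_iv/iv_v/v_ii.
  - by move=> /ii_iv/iv_i/i_vi/vi_iii.
  - exact: iii_iv.
  - exact: iv_v.
  - by move=> /v_ii/ii_iv/iv_i/i_vi.
  - by move=> /vi_iii/iii_iv/iv_i.
move=> /i_iv/ivP fin; split.
  move=> theta dQ OmegaQ PQ Q rep; have [th0 _ _] := rep.
  have spec A : measurable A -> (forall t : R, cadlag_shift t @^-1` A = A) ->
      theta%:E * distribution PQ Q A = \int[nu]_y ((reciprocal_exceed N y)%:E * (\1_A (normalize N y))%:E).
    by move=> mA As; rewrite (rep_spectral N_norm alpha_gt0 rep nuG).
  split => //.
    rewrite (tail_process_reciprocal N_norm Y_tail).
    (* The whole space is shift-invariant, so the identity for the law of Q already contains the
       value of theta. *)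
    have := spec setT measurableT; rewrite probability_setT mule1 => -> //.
    by apply: eq_integral => y _; rewrite indicT mule1.
  move=> A mA As; rewrite (spectral_lawE N_norm Y_tail)// -spec//.
  by rewrite muleA -EFinM mulVf ?mul1e// gt_eqF.
have [theta [dQ [OmegaQ [PQ [Q [rep thE QE]]]]]] :=
  exists_moving_shift N_norm alpha_gt0 nu_tail nu_shift fin.
exists theta, dQ, OmegaQ, PQ, Q; split => //.
  by rewrite (tail_process_reciprocal N_norm Y_tail).
by move=> A mA; rewrite (spectral_lawE N_norm Y_tail)// QE.
Qed.
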